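(* Let $\Theta\subseteq\mathcal{L}_{qf}$ be a set of Sahlqvist formulas such that the class $\mathsf{KFr}(\Theta)$ of Kripke frames validating $\Theta$ has diversity $n$ ($n$ a natural number). Then the logic $\mathsf{K}_\Pi\Theta\mathtt{Bc}\mathtt{At}^n\mathtt{R}^n$ is sound and strongly complete for $\mathsf{KFr}(\Theta)$. That is, every formula in this logic is valid on every frame in $\mathsf{KFr}(\Theta)$, and every set $\Gamma\subseteq\mathcal{L}$ that is consistent with respect to this logic is satisfiable at some world of some frame in $\mathsf{KFr}(\Theta)$ under some valuation.
   Context: Language. Fix a countably infinite (enumerated) set $\mathsf{Prop}$ of propositional variables. $\mathcal{L}$ is given by $\varphi::=p\mid\neg\varphi\mid(\varphi\vee\varphi)\mid\Diamond\varphi\mid\exists p\,\varphi$; $\wedge,\to,\leftrightarrow,\Box,\forall p$ are the usual abbreviations. $\mathcal{L}_{qf}$ is the quantifier-free fragment; $\mathsf{Fv}(\varphi)$ is the set of free variables. $\Diamond^0\varphi=\varphi$, $\Diamond^{k+1}\varphi=\Diamond\Diamond^k\varphi$, $\Diamond^{\le0}\varphi=\varphi$, $\Diamond^{\le k+1}\varphi=\Diamond^{\le k}\varphi\vee\Diamond^{k+1}\varphi$; $\Box^k,\Box^{\le k}$ are defined dually. Sahlqvist formulas are understood in the standard sense of propositional modal logic. Semantics. On a Kripke frame $(W,R)$ ($W\ne\varnothing$, $R\subseteq W^2$), a valuation is $v:\mathsf{Prop}\to\wp(W)$; $[\![p]\!](v)=v(p)$, $\neg,\vee$ are interpreted by complement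 and union, $[\![\Diamond\varphi]\!](v)=\{w\mid\exists u\in[\![\varphi]\!](v),\ wRu\}$, $[\![\exists p\,\varphi]\!](v)=\bigcup\{[\![\varphi]\!](v[X/p])\mid X\in\wp(W)\}$, where $v[X/p]$ agrees with $v$ except for sending $p$ to $X$. $\varphi$ is valid if $[\![\varphi]\!](v)=W$ for all $v$; $\Gamma$ is satisfied at $w$ under $v$ if $w\in[\![\varphi]\!](v)$ for all $\varphi\in\Gamma$. Diversity. Worlds $w,u$ of a Kripke frame $\mathbb F=(W,R)$ are duplicates if the permutation of $W$ exchanging $w$ and $u$ (and fixing everything else) is an automorphism of $\mathbb F$. This is an equivalence relation $\Delta$; the diversity of $\mathbb F$ is the cardinality of $W/\Delta$. The diversity of a class of Kripke frames is the supremum of the diversities of all point-generated subframes of frames in the class. Substitutions. A substitution is $\sigma:\mathsf{Prop}\to\mathcal{L}$; $\sigma_p^\psi$ agrees with $\sigma$ except that it sends $p$ to $\psi$. It extends to $\mathcal{L}$ by commuting with $\neg,\vee,\Diamond$ and $\sigma(\exists p\,\varphi)=\exists q\,\sigma_p^q(\varphi)$, where $q=p$ if $p\notin\bigcup_{r\in\mathsf{Fv}(\exists p\varphi)}\mathsf{Fv}(\sigma(r))$ and otherwise $q$ is the first variable not used in $\exists p\,\varphi$ nor in any $\sigma(r)$, $r\in\mathsf{Fv}(\exists p\,\varphi)$. $\iota$ is the identity substitution. Logics. A normal propositionally quantified modal logic (NPQML) is a set $\Lambda\subseteq\mathcal{L}$ such that: all propositional tautologies are in $\Lambda$; $\Box(p\to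 q)\to(\Box p\to\Box q)$ and $\Diamond p\leftrightarrow\neg\Box\neg p$ are in $\Lambda$; all instances of $\iota_p^\psi(\varphi)\to\exists p\,\varphi$ are in $\Lambda$; $\varphi\in\Lambda$ implies $\Box\varphi\in\Lambda$; $\varphi,\varphi\to\psi\in\Lambda$ imply $\psi\in\Lambda$; if $\varphi\to\psi\in\Lambda$ and $p\notin\mathsf{Fv}(\psi)$ then $\exists p\,\varphi\to\psi\in\Lambda$. $\mathsf{K}_\Pi A_1\dots A_k$ is the smallest NPQML containing all (instances of) $A_1,\dots,A_k$. A set $\Gamma$ is $\Lambda$-consistent if there is no finite $A\subseteq\Gamma$ with $\neg(\bigwedge A)\in\Lambda$. Axioms. $\mathtt{Bc}$ is the Barcan scheme $\Diamond\exists p\,\varphi\to\exists p\,\Diamond\varphi$. $\mathtt{Q}^n(\varphi)=\Diamond^{\le n}\varphi\wedge\forall p(\Box^{\le n}(\varphi\to p)\vee\Box^{\le n}(\varphi\to\neg p))$ with $p$ the first variable not in $\mathsf{Fv}(\varphi)$. $\mathtt{At}^n=\forall q(\Diamond^{\le n}q\to\exists p(\mathtt{Q}^n(p)\wedge\Box^{\le n}(p\to q)))$. $\mathtt{R}^n=\forall p\exists q(\Box^{\le n}(p\to\Box q)\wedge\forall r(\Box^{\le n}(p\to\Box r)\to\Box^{\le n}(q\to r)))$. *)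

(* Defs.v *)
From Stdlib Require Import Relation_Operators.
From Stdlib Require List.
From mathcomp Require Import all_boot.
From mathcomp Require Import boolp classical_sets cardinality.

Set Implicit Arguments.
Unset Strict Implicit.
Unset Printing Implicit Defensive.

Local Open Scope classical_set_scope.
Local Open Scope card_scope.

(** * Language *)

(* Propositional variables are natural numbers, enumerated in their order. *)
Inductive form : Type :=
| Var of nat
| Neg of form
| Or of form & form
| Dia of form
| Ex of nat & form.

Definition And (a b : form) : form := Neg (Or (Neg a) (Neg b)).
Definition Imp (a b : form) : form := Or (Neg a) b.
Definition Iff (a b : form) : form := And (Imp a b) (Imp b a).
Definition Box (a : form) : form := Neg (Dia (Neg a)).
Definition All (p : nat) (a : form) : form := Neg (Ex p (Neg a)).

(* The language has no constants; [Top p] is the constant true, written with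
   the variable [p]. *)
Definition Top (p : nat) : form := Or (Var p) (Neg (Var p)).

Definition bigAnd (s : seq form) : form := foldr And (Top 0) s.

Fixpoint quantifier_free (a : form) : Prop :=
  match a with
  | Var _ => True
  | Neg b | Dia b => quantifier_free b
  | Or b c => quantifier_free b /\ quantifier_free c
  | Ex _ _ => False
  end.

Fixpoint Fv (a : form) : seq nat :=
  match a with
  | Var p => [:: p]
  | Neg b | Dia b => Fv b
  | Or b c => Fv b ++ Fv c
  | Ex p b => [seq q <- Fv b | q != p]
  end.

(* All variables used in a formula: free, bound, or bound vacuously. *)
Fixpoint vars (a : form) : seq nat :=
  match a with
  | Var p => [:: p]
  | Neg b | Dia b => vars b
  | Or b c => vars b ++ vars c
  | Ex p b => p :: vars b
  end.

(* The least natural number not in [s]; it is at most [size s]. *)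
Definition first_notin (s : seq nat) : nat :=
  find (fun p => p \notin s) (iota 0 (size s).+1).

Definition DiaN (k : nat) (a : form) : form := iter k Dia a.
Definition BoxN (k : nat) (a : form) : form := iter k Box a.

Fixpoint DiaLe (k : nat) (a : form) : form :=
  if k is k'.+1 then Or (DiaLe k' a) (DiaN k a) else a.
Fixpoint BoxLe (k : nat) (a : form) : form :=
  if k is k'.+1 then And (BoxLe k' a) (BoxN k a) else a.

(** * Kripke semantics *)

Record frame : Type := Frame {
  world :> Type;
  acc : world -> world -> Prop;
  world_inhabited : inhabited world }.

Definition update (T : Type) (f : nat -> T) (p : nat) (x : T) : nat -> T :=
  fun q => if q == p then x else f q.

Fixpoint sem (F : frame) (v : nat -> set F) (a : form) : set F :=
  match a with
  | Var p => v p
  | Neg b => ~` sem v b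
  | Or b c => sem v b `|` sem v c
  | Dia b => [set w | exists2 u, sem v b u & acc w u]
  | Ex p b => \bigcup_(X in [set: set F]) sem (update v p X) b
  end.

Definition valid (F : frame) (a : form) : Prop :=
  forall v : nat -> set F, sem v a = [set: F].

Definition satisfied (F : frame) (v : nat -> set F) (w : F)
    (Gamma : set form) : Prop :=
  forall a, Gamma a -> sem v a w.

Definition KFr (Theta : set form) : set frame :=
  [set F | forall a, Theta a -> valid F a].

(** * Diversity *)

Definition swap (T : Type) (w u : T) : T -> T :=
  fun x => if `[< x = w >] then u else if `[< x = u >] then w else x.

Definition automorphism (F : frame) (f : F -> F) : Prop :=
  bijective f /\ forall x y : F, acc (f x) (f y) <-> acc x y.

Definition duplicates (F : frame) (w u : F) : Prop := automorphism (swap w u).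

(* The quotient of [F] by the duplicate relation, as a set of classes; the
   diversity of [F] is its cardinality. *)
Definition duplicate_classes (F : frame) : set (set F) :=
  range (fun w : F => [set u | duplicates w u]).
Arguments duplicate_classes F : clear implicits.

Definition generated_world (F : frame) (w : F) : Type :=
  {u : F | clos_refl_trans F (@acc F) w u}.

Definition generated_subframe (F : frame) (w : F) : frame :=
  @Frame (generated_world w) (fun x y => acc (sval x) (sval y))
    (inhabits (exist _ w (rt_refl F (@acc F) w))).

(* [n] is the supremum, among all cardinals, of the diversities of the
   point-generated subframes of frames in [K]. *)
Definition class_diversity (K : set frame) (n : nat) : Prop :=
  (forall (F : frame) (w : F), K F ->
     duplicate_classes (generated_subframe w) #<= `I_n) /\
  (forall (T : Type) (A : set T),
     (forall (F : frame) (w : F), K F ->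
        duplicate_classes (generated_subframe w) #<= A) ->
     `I_n #<= A).

(** * Sahlqvist formulas *)

(* [signed true a]: every variable occurrence in [a] is under an even number
   of negations ([a] is positive); [signed false a]: under an odd number ([a] is
   negative).  The constant [Top p], and hence its negation, has both signs. *)
Inductive signed : bool -> form -> Prop :=
| signed_Var p : signed true (Var p)
| signed_Top b p : signed b (Top p)
| signed_Neg b a : signed b a -> signed (~~ b) (Neg a)
| signed_Or b a c : signed b a -> signed b c -> signed b (Or a c)
| signed_Dia b a : signed b a -> signed b (Dia a).

Definition positive (a : form) : Prop := signed true a.
Definition negative (a : form) : Prop := signed false a.

(* True and false are covered by [sahl_ant_negative]. *)
Inductive sahlqvist_antecedent : form -> Prop :=
| sahl_ant_boxed_atom k p : sahlqvist_antecedent (BoxN k (Var p))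
| sahl_ant_negative a : negative a -> sahlqvist_antecedent a
| sahl_ant_And a b : sahlqvist_antecedent a -> sahlqvist_antecedent b ->
    sahlqvist_antecedent (And a b)
| sahl_ant_Or a b : sahlqvist_antecedent a -> sahlqvist_antecedent b ->
    sahlqvist_antecedent (Or a b)
| sahl_ant_Dia a : sahlqvist_antecedent a -> sahlqvist_antecedent (Dia a).

Inductive sahlqvist : form -> Prop :=
| sahl_Imp a b : sahlqvist_antecedent a -> positive b -> sahlqvist (Imp a b)
| sahl_Box a : sahlqvist a -> sahlqvist (Box a)
| sahl_And a b : sahlqvist a -> sahlqvist b -> sahlqvist (And a b)
| sahl_Or a b : sahlqvist a -> sahlqvist b ->
    (forall p, p \in Fv a -> p \notin Fv b) -> sahlqvist (Or a b).

(** * Substitution *)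

Fixpoint subst (s : nat -> form) (a : form) : form :=
  match a with
  | Var p => s p
  | Neg b => Neg (subst s b)
  | Or b c => Or (subst s b) (subst s c)
  | Dia b => Dia (subst s b)
  | Ex p b =>
      let q :=
        if p \notin flatten [seq Fv (s r) | r <- Fv (Ex p b)] then p
        else first_notin
               (vars (Ex p b) ++ flatten [seq vars (s r) | r <- Fv (Ex p b)]) in
      Ex q (subst (update s p (Var q)) b)
  end.

(** * Logics *)

(* Truth-functional tautologies of the full language: formulas whose main
   operator is neither [Neg] nor [Or] are treated as atoms. *)
Definition tautology (a : form) : Prop :=
  forall h : form -> bool,
    (forall b, h (Neg b) = ~~ h b) ->
    (forall b c, h (Or b c) = h b || h c) ->
    h a.

Record npqml (L : set form) : Prop := Npqml {
  npqml_taut : forall a, tautology a -> L a;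
  npqml_K : forall p q,
    L (Imp (Box (Imp (Var p) (Var q))) (Imp (Box (Var p)) (Box (Var q))));
  npqml_dual : forall p, L (Iff (Dia (Var p)) (Neg (Box (Neg (Var p)))));
  npqml_inst : forall p a b, L (Imp (subst (update Var p b) a) (Ex p a));
  npqml_nec : forall a, L a -> L (Box a);
  npqml_mp : forall a b, L a -> L (Imp a b) -> L b;
  npqml_exE : forall p a b, L (Imp a b) -> p \notin Fv b -> L (Imp (Ex p a) b) }.

Definition KPi (A : set form) : set form := smallest npqml A.

Definition consistent (L Gamma : set form) : Prop :=
  ~ exists2 s : seq form,
      (forall a, List.In a s -> Gamma a) & L (Neg (bigAnd s)).

Definition sound (L : set form) (K : set frame) : Prop :=
  forall a, L a -> forall F, K F -> valid F a.

Definition strongly_complete (L : set form) (K : set frame) : Prop :=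
  forall Gamma : set form, consistent L Gamma ->
    exists F : frame, K F /\
      exists (v : nat -> set F) (w : F), satisfied v w Gamma.

(** * Axioms *)

Definition Bc : set form :=
  [set c | exists p a, c = Imp (Dia (Ex p a)) (Ex p (Dia a))].

Definition Q (n : nat) (a : form) : form :=
  let p := first_notin (Fv a) in
  And (DiaLe n a)
      (All p (Or (BoxLe n (Imp a (Var p))) (BoxLe n (Imp a (Neg (Var p)))))).

(* In [At] and [Rax] the bound variables p, q, r are 0, 1, 2. *)
Definition At (n : nat) : form :=
  let p := 0 in let q := 1 in
  All q (Imp (DiaLe n (Var q))
             (Ex p (And (Q n (Var p)) (BoxLe n (Imp (Var p) (Var q)))))).

Definition Rax (n : nat) : form :=
  let p := 0 in let q := 1 in let r := 2 in
  All p (Ex q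
    (And (BoxLe n (Imp (Var p) (Box (Var q))))
         (All r (Imp (BoxLe n (Imp (Var p) (Box (Var r))))
                     (BoxLe n (Imp (Var q) (Var r))))))).

(* Main.v *)
(** Soundness is direct: [Bc], [At n] and [Rax n] hold on every frame.

Completeness starts from a witnessed maximal consistent set [w0].  Canonicity
of Sahlqvist formulas puts the canonical frame into [KFr Theta], so its
diversity is at most [n]; since the worlds of a shortest path after the first
one are never duplicates, [DiaLe n] reaches everything reachable.  Witnessed
sets connected to [w0] form a general frame whose admissible sets are the
definable ones.  By [At n] every nonempty admissible set contains an atom (a
world whose singleton is admissible), [w0] itself is an atom, and by [Rax n]
images of admissible sets are admissible up to non-atoms.  On the general frame
of atoms the minimal valuations of Sahlqvist antecedents are therefore
admissible, so its frame lies in [KFr Theta] and has finite diversity.  Finally,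
a frame with finitely many duplicate classes looks like a pure set with
finitely many colours, and a game argument counting colour classes up to a
threshold shows that quantifying over the admissible sets or over all sets
makes no difference. *)

Require Import Defs.
From Stdlib Require Import Relation_Operators.
From Stdlib Require List.
From mathcomp Require Import all_boot.
From mathcomp Require Import boolp classical_sets cardinality functions.

Set Implicit Arguments.
Unset Strict Implicit.
Unset Printing Implicit Defensive.

Local Open Scope classical_set_scope.

(** * Substitution *)

(** Two frames of maximal consistent sets are needed, for opposite reasons. Esakia's lemma requires
    successors that contain whole directed families of formulas, and these are not built with
    witnesses; the truth lemma for [Ex] requires witnesses. So canonicity is proved on the frame of
    all maximal consistent sets, and only its syntactic trace, the theorem
    [Imp (DiaN n.+1 a) (DiaLe n a)], is carried over to the witnessed frame. There it makes
    [DiaLe n] at the root a global modality as far as admissible sets can tell, which is why the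
    axioms with the bound [n] are strong enough.

    The Sahlqvist argument is run twice. It is therefore stated over a family [B] of admissible sets
    with one abstract hypothesis, [tight].

    In the final comparison a chosen set splits every colour class in two; hence counting thresholds
    double at each quantifier. *)

Lemma updE (T : Type) (f : nat -> T) p x : update f p x p = x.
Proof. by rewrite /update eqxx. Qed.

Lemma updN (T : Type) (f : nat -> T) p x q : q != p -> update f p x q = f q.
Proof. by rewrite /update => /negbTE ->. Qed.

Lemma upd_id (T : Type) (f : nat -> T) p : update f p (f p) = f.
Proof. by apply/funext => q; rewrite /update; case: eqP => [->|]. Qed.

Lemma upd_comp (T U : Type) (g : T -> U) (f : nat -> T) p x :
  (fun q => g (update f p x q)) = update (fun q => g (f q)) p (g x).
Proof. by apply/funext => q; rewrite /update; case: eqP. Qed.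

Lemma first_notinP s : first_notin s \notin s.
Proof.
set P := fun p => p \notin s.
have hP : has P (iota 0 (size s).+1).
  apply/negPn/negP => /hasPn h.
  have := @uniq_leq_size _ (iota 0 (size s).+1) s (iota_uniq _ _).
  rewrite size_iota ltnn => h'.
  suff : false by [].
  by apply: h' => x /h; rewrite /P negbK.
have := nth_find 0 hP; rewrite nth_iota ?add0n //.
by move: hP; rewrite has_find size_iota.
Qed.

Lemma Fv_vars a : {subset Fv a <= vars a}.
Proof.
elim: a => [p|a IH|a IHa b IHb|a IH|p a IH] x //=; try exact: IH.
  by rewrite !mem_cat => /orP[/IHa->|/IHb->//]; rewrite ?orbT.
by rewrite mem_filter inE => /andP[_ /IH ->]; rewrite orbT.
Qed.

Lemma mem_Fv_Ex p a r : (r \in Fv (Ex p a)) = (r != p) && (r \in Fv a).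
Proof. by rewrite /= mem_filter. Qed.

Definition exvar (s : nat -> form) (p : nat) (a : form) : nat :=
  if p \notin flatten [seq Fv (s r) | r <- Fv (Ex p a)] then p
  else first_notin
         (vars (Ex p a) ++ flatten [seq vars (s r) | r <- Fv (Ex p a)]).

Lemma subst_Ex s p a :
  subst s (Ex p a) =
  Ex (exvar s p a) (subst (update s p (Var (exvar s p a))) a).
Proof. by []. Qed.

Lemma exvar_fresh s p a r : r \in Fv (Ex p a) -> exvar s p a \notin Fv (s r).
Proof.
move=> hr; rewrite /exvar; case: ifP => [h|_].
  by apply: contra h => h; apply/flattenP; exists (Fv (s r)) => //; apply: map_f.
set l := _ ++ _; apply: contra (first_notinP l) => h.
rewrite {2}/l mem_cat; apply/orP; right.
by apply/flattenP; exists (vars (s r)); [apply: map_f|apply: Fv_vars].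
Qed.

Lemma subst_ext s t a : {in Fv a, s =1 t} -> subst s a = subst t a.
Proof.
elim: a s t => [p|a IH|a IHa b IHb|a IH|p a IH] s t h.
- by apply: h; rewrite inE.
- by congr Neg; apply: IH.
- by congr Or; [apply: IHa|apply: IHb] => x hx; apply: h; rewrite mem_cat hx ?orbT.
- by congr Dia; apply: IH.
rewrite !subst_Ex.
have -> : exvar s p a = exvar t p a.
  rewrite /exvar; have -> : [seq Fv (s r) | r <- Fv (Ex p a)] = [seq Fv (t r) | r <- Fv (Ex p a)].
    by apply/eq_in_map => r /h ->.
  by rewrite (_ : [seq vars (s r) | r <- _] = [seq vars (t r) | r <- Fv (Ex p a)]) //;
    apply/eq_in_map => r /h ->.
congr Ex; apply: IH => r hr; rewrite /update; case: eqP => // /eqP hrp.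
by apply: h; rewrite mem_Fv_Ex hrp.
Qed.

Lemma subst_id s a : {in Fv a, s =1 Var} -> subst s a = a.
Proof.
move=> h; rewrite (subst_ext h) {s h}.
elim: a => [p|a IH|a IHa b IHb|a IH|p a IH] //=; rewrite ?IH ?IHa ?IHb //.
case: ifPn => [_|/negPn /flattenP[]]; first by rewrite upd_id IH.
move=> _ /mapP[r hr ->]; rewrite inE => /eqP pr.
by move: hr; rewrite mem_filter pr eqxx.
Qed.

Lemma subst_update_notin p b a : p \notin Fv a -> subst (update Var p b) a = a.
Proof.
move=> hp; apply: subst_id => r hr; rewrite updN //.
by apply: contraNneq hp => <-.
Qed.

Lemma mem_Fv_subst s a x :
  (x \in Fv (subst s a)) = has (fun r => x \in Fv (s r)) (Fv a).
Proof.
elim: a s => [p|a IH|a IHa b IHb|a IH|p a IH] s; rewrite ?orbF //.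
- by rewrite /= orbF.
- exact: IH.
- by rewrite /= has_cat mem_cat IHa IHb.
- exact: IH.
rewrite subst_Ex mem_Fv_Ex IH; set q := exvar s p a.
apply/andP/hasP => [[xq /hasP[r ra]]|[r]].
  rewrite /update; case: eqP => [_|/eqP rp h]; first by rewrite inE (negbTE xq).
  by exists r => //; rewrite mem_Fv_Ex rp.
rewrite mem_Fv_Ex => /andP[rp ra] h; split.
  have := @exvar_fresh s p a r; rewrite mem_Fv_Ex rp ra => /(_ isT) fr.
  by apply: contraNneq fr => e; rewrite -/q -e.
by apply/hasP; exists r => //; rewrite updN.
Qed.

Lemma DiaLeS k a : DiaLe k.+1 a = Or (DiaLe k a) (DiaN k.+1 a).
Proof. by []. Qed.

Lemma BoxLeS k a : BoxLe k.+1 a = And (BoxLe k a) (BoxN k.+1 a).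
Proof. by []. Qed.

(** * General semantics *)

Section Gsem.
Variable F : frame.
Implicit Types (B : set (set F)) (v : nat -> set F).

Fixpoint gsem B v (a : form) : set F :=
  match a with
  | Var p => v p
  | Neg b => ~` gsem B v b
  | Or b c => gsem B v b `|` gsem B v c
  | Dia b => [set w | exists2 u, gsem B v b u & acc w u]
  | Ex p b => \bigcup_(X in B) gsem B (update v p X) b
  end.

Lemma gsemT v a : gsem setT v a = sem v a.
Proof.
elim: a v => [p|a IH|a IHa b IHb|a IH|p a IH] v //=; rewrite ?IH ?IHa ?IHb //.
by apply: eq_bigcupr => X _; rewrite IH.
Qed.

Lemma gsem_qf B v a : quantifier_free a -> gsem B v a = sem v a.
Proof.
elim: a => [p|a IH|a IHa b IHb|a IH|p a IH] //= h; rewrite ?IH //.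
by case: h => ha hb; rewrite IHa // IHb.
Qed.

Lemma gsem_ext B v v' a : {in Fv a, v =1 v'} -> gsem B v a = gsem B v' a.
Proof.
elim: a v v' => [p|a IH|a IHa b IHb|a IH|p a IH] v v' h /=.
- by apply: h; rewrite inE.
- by rewrite (IH _ _ h).
- by rewrite (IHa v v') ?(IHb v v') // => x hx; apply: h; rewrite mem_cat hx ?orbT.
- by rewrite (IH _ _ h).
apply: eq_bigcupr => X _; apply: IH => r hr; rewrite /update.
by case: eqP => // /eqP rp; apply: h; rewrite mem_Fv_Ex rp.
Qed.

(** The bound variable picked by [subst] is not free in the formulas substituted under it
    ([exvar_fresh]), so reassigning it does not disturb their values. *)
Lemma gsem_subst B v s a :
  gsem B v (subst s a) = gsem B (fun r => gsem B v (s r)) a.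
Proof.
elim: a v s => [p|a IH|a IHa b IHb|a IH|p a IH] v s.
- by [].
- by rewrite /= IH.
- by rewrite /= IHa IHb.
- by rewrite /= IH.
rewrite subst_Ex /=; apply: eq_bigcupr => X _; rewrite IH.
apply: gsem_ext => r hr; rewrite /update; case: eqP => [_|/eqP rp] /=.
  by rewrite eqxx.
have hr' : r \in Fv (Ex p a) by rewrite mem_Fv_Ex rp.
apply: gsem_ext => x hx; rewrite ifN //.
by apply: contraNneq (exvar_fresh s hr') => <-.
Qed.

Lemma gsem_Imp B v a b w :
  gsem B v (Imp a b) w <-> (gsem B v a w -> gsem B v b w).
Proof.
rewrite /Imp /=; split=> [[]//|h].
by case: (pselect (gsem B v a w)) => [/h|]; [right|left].
Qed.

Lemma gsem_Or B v a b w :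
  gsem B v (Or a b) w <-> gsem B v a w \/ gsem B v b w.
Proof. by []. Qed.

Lemma gsem_And B v a b w :
  gsem B v (And a b) w <-> gsem B v a w /\ gsem B v b w.
Proof.
rewrite /And /=; split=> [h|[ha hb] []//].
by split; apply: contrapT => h'; apply: h; [left|right].
Qed.

Lemma gsem_Box B v a w :
  gsem B v (Box a) w <-> forall u, acc w u -> gsem B v a u.
Proof.
rewrite /Box /=; split=> [h u wu|h [u hu wu]]; last by apply: hu; apply: h.
by apply: contrapT => hu; apply: h; exists u.
Qed.

Lemma gsem_All B v p a w :
  gsem B v (All p a) w <-> forall X, B X -> gsem B (update v p X) a w.
Proof.
rewrite /All /=; split=> [h X BX|h [X BX]]; last by apply; apply: h.
by apply: contrapT => hu; apply: h; exists X.
Qed.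

Lemma gsem_Ex B v p a w :
  gsem B v (Ex p a) w <-> exists2 X, B X & gsem B (update v p X) a w.
Proof. by []. Qed.

Fixpoint racc (k : nat) (x y : F) : Prop :=
  if k is k'.+1 then exists2 z, acc x z & racc k' z y else x = y.

Lemma raccS k x y z : racc k x y -> acc y z -> racc k.+1 x z.
Proof.
elim: k x => [|k IH] x; first by move=> /= -> yz; exists z.
by case=> u xu /IH h /h; exists u.
Qed.

Lemma raccSr k x z : racc k.+1 x z -> exists2 y, racc k x y & acc y z.
Proof.
elim: k x => [|k IH] x; first by case=> y xy /= <-; exists x.
by case=> u xu /IH[y uy yz]; exists y => //; exists u.
Qed.

Lemma gsem_DiaN B v k a w :
  gsem B v (DiaN k a) w <-> exists2 u, racc k w u & gsem B v a u.
Proof.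
elim: k w => [|k IH] w; first by split=> [h|[u /= ->]//]; exists w.
split=> [[u /IH[y uy hy] wu]|[y [u wu uy] hy]]; first by exists y => //; exists u.
by exists u => //; apply/IH; exists y.
Qed.

Lemma gsem_BoxN B v k a w :
  gsem B v (BoxN k a) w <-> forall u, racc k w u -> gsem B v a u.
Proof.
elim: k w => [|k IH] w; first by split=> [h u <-//|]; apply.
rewrite /BoxN iterS -/(BoxN k a) gsem_Box; split=> [h u [y wy yu]|h u wu].
  by have /IH := h _ wy; apply.
by apply/IH => y uy; apply: h; exists u.
Qed.

Lemma gsem_DiaLe B v k a w :
  gsem B v (DiaLe k a) w <->
  exists j u, [/\ j <= k, racc j w u & gsem B v a u].
Proof.
elim: k => [|k IH].
  by split=> [h|[[|j] [u [//= _ -> //]]]]; exists 0, w.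
rewrite DiaLeS gsem_Or; split=> [[/IH[j [u [h1 h2 h3]]]|]|].
- by exists j, u; split=> //; apply: leq_trans h1 _.
- by move=> /gsem_DiaN[u h1 h2]; exists k.+1, u.
case=> j [u [jk wu hu]]; move: jk; rewrite leq_eqVlt => /orP[/eqP jk|jk].
  by right; apply/gsem_DiaN; exists u => //; rewrite -jk.
by left; apply/IH; exists j, u.
Qed.

Lemma gsem_BoxLe B v k a w :
  gsem B v (BoxLe k a) w <->
  forall j u, j <= k -> racc j w u -> gsem B v a u.
Proof.
elim: k => [|k IH]; first by split=> [h [|//] u _ <- //|/(_ 0 w)]; apply.
rewrite BoxLeS gsem_And; split=> [[/IH h1 /gsem_BoxN h2] j u|h].
  by rewrite leq_eqVlt => /orP[/eqP ->|jk]; [apply: h2|apply: h1].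
by split; [apply/IH => j u jk; apply: h; apply: leq_trans jk _|apply/gsem_BoxN => u;
  apply: h].
Qed.

(** So [Q n] expresses an atom of [B] as seen from [w] within [n] steps: no admissible set splits
    it. *)
Lemma gsem_Q B v n p w :
  gsem B v (Q n (Var p)) w <->
  (exists j u, [/\ j <= n, racc j w u & v p u]) /\
  forall X, B X ->
    (forall j u, j <= n -> racc j w u -> v p u -> X u) \/
    (forall j u, j <= n -> racc j w u -> v p u -> ~ X u).
Proof.
rewrite /Q gsem_And gsem_DiaLe gsem_All; set q := first_notin _.
have pq : p == q = false.
  by apply/negbTE; have := first_notinP [:: p]; rewrite inE eq_sym.
suff h X : gsem B (update v q X) (Or (BoxLe n (Imp (Var p) (Var q)))
             (BoxLe n (Imp (Var p) (Neg (Var q))))) w <->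
   ((forall j u, j <= n -> racc j w u -> v p u -> X u) \/
    (forall j u, j <= n -> racc j w u -> v p u -> ~ X u)).
  by split=> -[h1 h2]; split=> // X BX; apply/h; apply: h2.
have e1 : update v q X p = v p by rewrite /update pq.
have e2 : update v q X q = X by rewrite /update eqxx.
rewrite gsem_Or !gsem_BoxLe; split=> -[] h.
- by left=> j u jn wu; have := h j u jn wu; rewrite gsem_Imp /= e1 e2.
- by right=> j u jn wu; have := h j u jn wu; rewrite gsem_Imp /= e1 e2.
- by left=> j u jn wu; have := h j u jn wu; rewrite gsem_Imp /= e1 e2.
- by right=> j u jn wu; have := h j u jn wu; rewrite gsem_Imp /= e1 e2.
Qed.

Lemma gsem_At B v n w :
  gsem B v (At n) w <->
  forall X, B X -> (exists j u, [/\ j <= n, racc j w u & X u]) ->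
    exists Y, [/\ B Y, exists j u, [/\ j <= n, racc j w u & Y u],
      forall Z, B Z ->
        (forall j u, j <= n -> racc j w u -> Y u -> Z u) \/
        (forall j u, j <= n -> racc j w u -> Y u -> ~ Z u) &
      forall j u, j <= n -> racc j w u -> Y u -> X u].
Proof.
rewrite /At gsem_All; split=> h X BX.
  move: (h X BX) => /gsem_Imp {}h hX; move: h => /(_ _)/gsem_Ex[|Y BY /gsem_And];
    first by apply/gsem_DiaLe.
  move=> [/gsem_Q[h1 h2] /gsem_BoxLe h3].
  by exists Y; split=> // j u jn wu; have /gsem_Imp := h3 j u jn wu.
apply/gsem_Imp => /gsem_DiaLe /(h _ BX)[Y [BY h1 h2 h3]]; apply/gsem_Ex; exists Y => //.
apply/gsem_And; split; first by apply/gsem_Q.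
by apply/gsem_BoxLe => j u jn wu; apply/gsem_Imp; apply: h3 jn wu.
Qed.

(** [Y] acts, within [n] steps, as the least admissible set above the image of [X]; it stands in for
    the backward modality that the language lacks. *)
Lemma gsem_Rax B v n w :
  gsem B v (Rax n) w <->
  forall X, B X -> exists2 Y, B Y &
    (forall j u, j <= n -> racc j w u -> X u -> forall z, acc u z -> Y z) /\
    forall Z, B Z ->
      (forall j u, j <= n -> racc j w u -> X u -> forall z, acc u z -> Z z) ->
      forall j u, j <= n -> racc j w u -> Y u -> Z u.
Proof.
rewrite /Rax gsem_All; split=> h X BX.
  have /gsem_Ex[Y BY /gsem_And[/gsem_BoxLe h1 /gsem_All h2]] := h X BX;
    exists Y => //; split.
    by move=> j u jn wu; move: (h1 j u jn wu) => /gsem_Imp {}h1 /h1 /gsem_Box.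
  move=> Z BZ hZ j u jn wu; have /gsem_Imp h3 := h2 Z BZ.
  suff /h3 /gsem_BoxLe/(_ j u jn wu)/gsem_Imp :
    gsem B (update (update (update v 0 X) 1 Y) 2 Z) (BoxLe n (Imp (Var 0) (Box (Var 2)))) w by [].
  by apply/gsem_BoxLe => j' u' jn' wu'; apply/gsem_Imp => Xu; apply/gsem_Box;
    apply: hZ jn' wu' Xu.
case: (h X BX) => Y BY [h1 h2]; apply/gsem_Ex; exists Y => //; apply/gsem_And; split.
  by apply/gsem_BoxLe => j u jn wu; apply/gsem_Imp => Xu; apply/gsem_Box;
    apply: h1 jn wu Xu.
apply/gsem_All => Z BZ; apply/gsem_Imp => /gsem_BoxLe h3.
apply/gsem_BoxLe => j u jn wu; apply/gsem_Imp; apply: (h2 Z BZ _ j u jn wu).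
by move=> j' u' jn' wu' Xu; have /gsem_Imp/(_ Xu)/gsem_Box := h3 j' u' jn' wu'.
Qed.

End Gsem.

(** * Soundness *)

Lemma npqml_valid (K : set frame) :
  npqml [set a | forall F, K F -> valid F a].
Proof.
split.
- move=> a ta F _ v; rewrite -subTset => w _.
  have := ta (fun b => `[< sem v b w >]) _ _ => h; apply/asboolP/h.
    by move=> b; rewrite -asbool_neg.
  by move=> b c; rewrite -asbool_or.
- move=> p q F _ v; rewrite -gsemT -subTset => w _.
  apply/gsem_Imp => /gsem_Box h1; apply/gsem_Imp => /gsem_Box h2.
  apply/gsem_Box => u wu; have /gsem_Imp := h1 u wu; apply; exact: h2.
- move=> p F _ v; rewrite -gsemT -subTset => w _; apply/gsem_And.
  split; apply/gsem_Imp.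
    move=> [u hu wu] h; have /gsem_Box := h : gsem setT v (Box (Neg (Var p))) w.
    by move=> /(_ u wu).
  move=> h; apply: contrapT => h'; apply: h.
  suff : gsem setT v (Box (Neg (Var p))) w by []; apply/gsem_Box => u wu hu.
  by apply: h'; exists u.
- move=> p a b F _ v; rewrite -gsemT -subTset => w _.
  apply/gsem_Imp; rewrite gsem_subst (upd_comp (gsem setT v)) => h.
  by exists (gsem setT v b).
- move=> a ha F KF v; rewrite -gsemT -subTset => w _.
  by apply/gsem_Box => u _; rewrite gsemT (ha F KF).
- move=> a b ha hb F KF v; have := hb F KF v; rewrite -!gsemT -!subTset.
  move=> {}hb w _; have /gsem_Imp := hb w I; apply; by rewrite gsemT (ha F KF).
- move=> p a b hab pb F KF v; rewrite -gsemT -subTset => w _.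
  apply/gsem_Imp => -[X _ hX].
  rewrite -(@gsem_ext _ _ (update v p X)); last first.
    by move=> r hr; rewrite updN //; apply: contraNneq pb => <-.
  have := hab F KF (update v p X); rewrite -!gsemT -!subTset => /(_ w I).
  by move=> /gsem_Imp; apply.
Qed.

Lemma valid_Bc F : Bc `<=` valid F.
Proof.
move=> _ [p [a ->]] v; rewrite -gsemT -subTset => w _; apply/gsem_Imp.
by move=> [u [X _ hX] wu]; exists X => //; exists u.
Qed.

Lemma valid_At F n : valid F (At n).
Proof.
move=> v; rewrite -gsemT -subTset => w _; apply/gsem_At => X _ [j [u [jn wu Xu]]].
exists [set u]; split=> //; [by exists j, u| |by move=> _ _ _ _ ->].
by move=> Z _; case: (pselect (Z u)) => h; [left|right] => _ _ _ _ ->.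
Qed.

Lemma valid_Rax F n : valid F (Rax n).
Proof.
move=> v; rewrite -gsemT -subTset => w _; apply/gsem_Rax => X _.
exists [set z | exists j u, [/\ j <= n, racc j w u, X u & acc u z]] => //.
split=> [j u jn wu Xu z uz|Z _ h j u _ _ [i [z [jn wu Xu zu]]]]; first by exists j, u.
exact: h jn wu Xu u zu.
Qed.

Lemma soundness (Theta : set form) (n : nat) :
  sound (KPi (Theta `|` Bc `|` [set At n] `|` [set Rax n])) (KFr Theta).
Proof.
move=> a La F KF; apply: (La [set b | forall G, KFr Theta G -> valid G b]) => //.
split; first exact: npqml_valid.
move=> b [[[Tb|Bb]| ->]| ->] G KG.
- exact: KG _ Tb.
- exact: valid_Bc Bb.
- exact: valid_At.
- exact: valid_Rax.
Qed.

(** * Derived rules *)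

(** Truth tables: [hN] and [hO] push the valuation [h] inwards, and the values that remain are
    split. *)
Ltac taut :=
  let h := fresh "h" in let hN := fresh "hN" in let hO := fresh "hO" in
  intros h hN hO; rewrite /Iff /Imp /And /Top ?(hN, hO);
  repeat match goal with |- context [h ?x] => case: (h x) end; done.

Lemma npqml_smallest (A : set form) : npqml (KPi A).
Proof.
split.
- by move=> a ta M [HM _]; apply: (npqml_taut HM).
- by move=> p q M [HM _]; apply: (npqml_K HM).
- by move=> p M [HM _]; apply: (npqml_dual HM).
- by move=> p a b M [HM _]; apply: (npqml_inst HM).
- by move=> a La M HM; apply: (npqml_nec HM.1); apply: La.
- by move=> a b La Lab M HM; apply: (npqml_mp HM.1) (La M HM) (Lab M HM).
- by move=> p a b Lab pb M HM; apply: (npqml_exE HM.1) (Lab M HM) pb.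
Qed.

Section Logic.
Variables (L : set form) (HL : npqml L).

Let mp a b := @npqml_mp L HL a b.

Lemma L_taut a : tautology a -> L a.
Proof. exact: npqml_taut. Qed.

Lemma L_taut1 a b : L a -> tautology (Imp a b) -> L b.
Proof. by move=> La /L_taut; apply: mp. Qed.

Lemma L_taut2 a b c : L a -> L b -> tautology (Imp a (Imp b c)) -> L c.
Proof. by move=> La Lb /L_taut/(mp La); apply: mp. Qed.

Lemma L_trans a b c : L (Imp a b) -> L (Imp b c) -> L (Imp a c).
Proof. by move=> h1 h2; apply: L_taut2 h1 h2 _; taut. Qed.

Lemma L_refl a : L (Imp a a).
Proof. by apply: L_taut; taut. Qed.

Lemma L_contra a b : L (Imp a b) -> L (Imp (Neg b) (Neg a)).
Proof. by move=> h; apply: L_taut1 h _; taut. Qed.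

Lemma L_gen p a : L a -> L (All p a).
Proof.
(* Falsity has to be written with some variable; [q] differs from [p], so that the quantifier rule
   applies to [p]. *)
move=> La; set q := p.+1.
have : L (Imp (Neg a) (Neg (Top q))) by apply: L_taut1 La _; taut.
move=> /(npqml_exE HL (p := p)) h.
have : L (Imp (Ex p (Neg a)) (Neg (Top q))).
  by apply: h; rewrite /Top /= !inE orbb /q neq_ltn ltnSn.
by move=> h'; apply: L_taut1 h' _; taut.
Qed.

Lemma L_inst p a b : L (Imp (All p a) (subst (update Var p b) a)).
Proof.
have := npqml_inst HL p (Neg a) b => h; apply: L_taut1 h _ => /=; taut.
Qed.

Lemma L_subst1 p a b : L a -> L (subst (update Var p b) a).
Proof. by move=> /(L_gen p)/mp; apply; apply: L_inst. Qed.

(** The axiom is given for variables only. Two single substitutions yield the scheme: [a] for [p],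
    then [b] for [q], where [q] is fresh for [a] so that the second leaves [a] alone. *)
Lemma L_K a b : L (Imp (Box (Imp a b)) (Imp (Box a) (Box b))).
Proof.
pose q := first_notin (Fv a); pose p := q.+1.
have := L_subst1 p a (npqml_K HL p q).
have qp : q == p = false by rewrite /p ltn_eqF.
rewrite /Box /Imp /= /update !eqxx qp => /(L_subst1 q b).
rewrite /= !subst_update_notin ?first_notinP //= /update !eqxx.
by [].
Qed.

Lemma L_dual a : L (Iff (Dia a) (Neg (Box (Neg a)))).
Proof.
by have := L_subst1 0 a (npqml_dual HL 0); rewrite /Iff /And /Imp /Box /= /update.
Qed.

Lemma L_Box a b : L (Imp a b) -> L (Imp (Box a) (Box b)).
Proof. by move=> /(npqml_nec HL)/mp; apply; apply: L_K. Qed.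

Lemma L_Dia a b : L (Imp a b) -> L (Imp (Dia a) (Dia b)).
Proof.
move=> /L_contra/L_Box/L_contra h; have ha := L_dual a; have hb := L_dual b.
have h1 : L (Imp (Dia a) (Neg (Box (Neg a)))) by apply: L_taut1 ha _; taut.
have h2 : L (Imp (Neg (Box (Neg b))) (Dia b)) by apply: L_taut1 hb _; taut.
exact: L_trans h1 (L_trans h h2).
Qed.

Lemma L_DiaN k a b : L (Imp a b) -> L (Imp (DiaN k a) (DiaN k b)).
Proof. by move=> h; elim: k => [//|k IH]; apply: L_Dia. Qed.

Lemma L_Dia_false a : L (Neg a) -> L (Neg (Dia a)).
Proof.
move=> h; have h0 : L (Imp a (Neg (Top 0))) by apply: L_taut1 h _; taut.
have ht : L (Box (Top 0)) by apply: npqml_nec HL _ _; apply: L_taut; taut.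
have hc : L (Imp (Dia (Neg (Top 0))) (Neg (Box (Top 0)))).
  by rewrite /Box; apply: L_taut; taut.
by apply: L_taut2 (L_trans (L_Dia h0) hc) ht _; taut.
Qed.

Lemma L_Ex_intro p a : L (Imp a (Ex p a)).
Proof. by have := npqml_inst HL p a (Var p); rewrite upd_id subst_id. Qed.

Lemma L_Ex p a b : L (Imp a b) -> L (Imp (Ex p a) (Ex p b)).
Proof.
move=> h; apply: npqml_exE HL _ _ _ (L_trans h (L_Ex_intro p b)) _.
by rewrite mem_Fv_Ex eqxx.
Qed.

(** Substitution renames bound variables, so iterated substitutions are compared only up to this
    provable equivalence. *)
Definition eqv a b := L (Imp a b) /\ L (Imp b a).

Lemma eqv_refl a : eqv a a.
Proof. by split; apply: L_refl. Qed.

Lemma eqv_trans a b c : eqv a b -> eqv b c -> eqv a c.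
Proof. by move=> [h1 h2] [h3 h4]; split; [apply: L_trans h3|apply: L_trans h4 _]. Qed.

Lemma eqv_L a b : eqv a b -> L a -> L b.
Proof. by move=> [h _] /mp; apply. Qed.

(** One half of renaming a bound variable. The composition law for the body is a premise because
    this is used inside the induction that proves [subst_comp]. *)
Let alpha_step u p a q q' :
  (forall s t, eqv (subst t (subst s a)) (subst (fun r => subst t (s r)) a)) ->
  (forall r, r \in Fv (Ex p a) -> q \notin Fv (u r)) ->
  (forall r, r \in Fv (Ex p a) -> q' \notin Fv (u r)) ->
  L (Imp (Ex q (subst (update u p (Var q)) a))
         (Ex q' (subst (update u p (Var q')) a))).
Proof.
move=> comp qf q'f; set c := subst (update u p (Var q')) a.
have [_ h1] := comp (update u p (Var q')) (update Var q' (Var q)).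
rewrite (@subst_ext _ (update u p (Var q))) in h1; last first.
  move=> r hr; rewrite /update; case: eqP => [_|/eqP rp] /=; first by rewrite eqxx.
  by apply: subst_update_notin; apply: q'f; rewrite mem_Fv_Ex rp.
apply: npqml_exE HL _ _ _ (L_trans h1 (npqml_inst HL _ _ _)) _.
rewrite mem_Fv_Ex negb_and negbK; case: eqVneq => //= qq'.
rewrite mem_Fv_subst; apply/hasPn => r hr; rewrite /update.
case: eqP => [_|/eqP rp]; first by rewrite inE.
by apply: qf; rewrite mem_Fv_Ex rp.
Qed.

(** The two sides may choose different bound variables. At a quantifier the induction hypothesis
    gives the right-hand side with bound variable [q'], and [alpha_step] passes from [q'] to
    [q'']. *)
Lemma subst_comp s t a :
  eqv (subst t (subst s a)) (subst (fun r => subst t (s r)) a).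
Proof.
elim: a s t => [p|a IH|a IHa b IHb|a IH|p a IH] s t.
- exact: eqv_refl.
- by have [h1 h2] := IH s t; split; apply: L_contra.
- have [h1 h2] := IHa s t; have [h3 h4] := IHb s t.
  by split => /=; [apply: L_taut2 h1 h3 _|apply: L_taut2 h2 h4 _]; taut.
- by have [h1 h2] := IH s t; split; apply: L_Dia.
set u := fun r => subst t (s r).
rewrite (subst_Ex s); set q := exvar s p a; set c := subst _ a.
rewrite (subst_Ex t) (subst_Ex u); set q' := exvar t q c; set q'' := exvar u p a.
have qf r : r \in Fv (Ex p a) -> q \notin Fv (s r) by apply: exvar_fresh.
have q'f r : r \in Fv (Ex p a) -> q' \notin Fv (u r).
  move=> hr; rewrite mem_Fv_subst; apply/hasPn => x hx.
  apply: exvar_fresh; rewrite -[Ex q c]/(subst s (Ex p a)) mem_Fv_subst.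
  by apply/hasP; exists r.
have q''f r : r \in Fv (Ex p a) -> q'' \notin Fv (u r) by apply: exvar_fresh.
apply: (@eqv_trans _ (Ex q' (subst (update u p (Var q')) a))); last first.
  by split; apply: alpha_step.
have := IH (update s p (Var q)) (update t q (Var q')).
rewrite (@subst_ext (fun r => subst (update t q (Var q')) (update s p (Var q) r)) (update u p (Var q'))).
  by case=> h1 h2; split; apply: L_Ex.
move=> r hr; rewrite /update; case: eqP => [_|/eqP rp] /=; first by rewrite eqxx.
apply: subst_ext => x hx; rewrite ifN //; apply: contraTneq hx => ->.
by apply: qf; rewrite mem_Fv_Ex rp.
Qed.

Lemma subst_subst1 s p q b c :
  (forall r, r \in Fv (Ex p b) -> q \notin Fv (s r)) ->
  eqv (subst (update Var q c) (subst (update s p (Var q)) b))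
      (subst (update s p c) b).
Proof.
move=> qf; apply: eqv_trans (subst_comp _ _ _) _.
rewrite (@subst_ext _ (update s p c)); first exact: eqv_refl.
move=> r hr; rewrite /update; case: eqP => [_|/eqP rp] /=; first by rewrite eqxx.
by apply: subst_update_notin; apply: qf; rewrite mem_Fv_Ex rp.
Qed.

Lemma L_Ex_rename p q a :
  q \notin Fv (Ex p a) -> L (Imp (Ex p a) (Ex q (subst (update Var p (Var q)) a))).
Proof.
move=> qa; have := @alpha_step Var p a p q (fun s t => subst_comp s t a).
rewrite upd_id subst_id //; apply => r; rewrite inE.
  by rewrite mem_Fv_Ex eq_sym => /andP[].
by move=> hr; apply: contraNneq qa => ->.
Qed.

(** A simultaneous substitution is performed one variable at a time, which is harmless when no free
    variable of [a] occurs in the substituted formulas. *)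
Let L_subst_fresh s a :
  (forall p r, p \in Fv a -> r \in Fv a -> p \notin Fv (s r)) ->
  L a -> L (subst s a).
Proof.
move=> fr La.
suff h (l : seq nat) : L (subst (fun r => if r \in l then s r else Var r) a).
  by have := h (Fv a); rewrite (@subst_ext _ s) // => r ->.
elim: l => [|p l IH]; first by rewrite subst_id.
case: (boolP ((p \in Fv a) && (p \notin l))) => [/andP[pa pl]|hp]; last first.
  rewrite (@subst_ext _ (fun r => if r \in l then s r else Var r)) // => r hr.
  rewrite inE; case: (eqVneq r p) => //= rp; move: hp; rewrite -rp hr /= negbK.
  by move=> ->.
have := eqv_L (subst_comp _ _ _) (L_subst1 p (s p) IH).
rewrite (@subst_ext _ (fun r => if r \in p :: l then s r else Var r)) // => r hr.
rewrite inE; case: (eqVneq r p) => [->|rp] /=.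
  by rewrite (negbTE pl) /= updE.
case: ifP => _ /=; last by rewrite updN.
by apply: subst_update_notin; apply: fr.
Qed.

(** The free variables of [a] are first shifted past [N], then [s] is applied to the shifted copy;
    both steps meet the condition of [L_subst_fresh]. *)
Lemma L_subst s a : L a -> L (subst s a).
Proof.
move=> La; pose l := Fv a ++ flatten [seq Fv (s r) | r <- Fv a].
pose N := (\max_(p <- l) p).+1.
have lN p : p \in l -> p < N by move=> pl; rewrite ltnS (leq_bigmax_seq (F := id)).
have aN p : p \in Fv a -> p < N by move=> pa; apply: lN; rewrite mem_cat pa.
pose s1 r := Var (r + N); pose s2 r := s (r - N).
have La1 : L (subst s1 a).
  apply: L_subst_fresh La => p r /aN pN _; rewrite inE.
  by rewrite ltn_eqF // (leq_trans pN) // leq_addl.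
have La2 : L (subst s2 (subst s1 a)).
  apply: L_subst_fresh La1 => p r.
  rewrite !mem_Fv_subst => /hasP[x _]; rewrite inE => /eqP -> /hasP[y hy].
  rewrite inE => /eqP ->; rewrite /s2 addnK.
  apply: contraTN (leq_addl x N) => h; rewrite -ltnNge; apply: lN.
  rewrite mem_cat; apply/orP; right; apply/flattenP.
  by exists (Fv (s y)) => //; apply: map_f.
have := eqv_L (subst_comp _ _ _) La2; rewrite (@subst_ext _ s) // => r _.
by rewrite /s1 /s2 /= addnK.
Qed.

End Logic.

(** * Maximal consistent sets *)

Fixpoint form_code (a : form) : GenTree.tree nat :=
  match a with
  | Var p => GenTree.Leaf p
  | Neg b => GenTree.Node 0 [:: form_code b]
  | Or b c => GenTree.Node 1 [:: form_code b; form_code c]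
  | Dia b => GenTree.Node 2 [:: form_code b]
  | Ex p b => GenTree.Node 3 [:: GenTree.Leaf p; form_code b]
  end.

Lemma form_code_inj : injective form_code.
Proof.
elim=> [p|a IH|a IHa b IHb|a IH|p a IH] [q|c|c d|c|q c] //=.
- by case=> ->.
- by case=> /IH ->.
- by case=> /IHa -> /IHb ->.
- by case=> /IH ->.
- by case=> -> /IH ->.
Qed.

Lemma form_enum : exists e : nat -> form, forall a, exists k, e k = a.
Proof.
have h k : exists b, forall a, pickle (form_code a) = k -> b = a.
  case: (pselect (exists a, pickle (form_code a) = k)) => [[a <-]|h].
    by exists a => b /(pcan_inj pickleK)/form_code_inj.
  by exists (Var 0) => a ha; case: h; exists a.
have [e he] := choice h.
by exists e => a; exists (pickle (form_code a)); apply: he.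
Qed.

Section Mcs.
Variables (L : set form) (HL : npqml L).

Record mcs (x : set form) : Prop := Mcs {
  mcs_L : L `<=` x;
  mcs_mp : forall a b, x a -> x (Imp a b) -> x b;
  mcs_neg : forall a, x (Neg a) <-> ~ x a }.

(** Witnesses are arbitrary formulas, because the quantifiers will range over the sets that formulas
    define. *)
Definition witnessed (x : set form) : Prop :=
  forall p a, x (Ex p a) -> exists b, x (subst (update Var p b) a).

Definition canon_acc (x y : set form) : Prop := forall a, y a -> x (Dia a).

Lemma mcs_LImp x a b : mcs x -> L (Imp a b) -> x a -> x b.
Proof. by move=> mx /(mcs_L mx) h /(mcs_mp mx); apply. Qed.

Lemma mcs_eqv x a b : mcs x -> eqv L a b -> x a <-> x b.
Proof. by move=> mx [h1 h2]; split; apply: mcs_LImp. Qed.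

Lemma mcs_L2 x a b c : mcs x -> L (Imp a (Imp b c)) -> x a -> x b -> x c.
Proof. by move=> mx h xa xb; apply: (mcs_mp mx xb); apply: mcs_LImp h xa. Qed.

Lemma mcs_and x a b : mcs x -> x (And a b) <-> x a /\ x b.
Proof.
move=> mx; split=> [h|[]]; first split.
- by apply: mcs_LImp h => //; apply: L_taut => //; taut.
- by apply: mcs_LImp h => //; apply: L_taut => //; taut.
by apply: mcs_L2 => //; apply: L_taut => //; taut.
Qed.

Lemma mcs_or x a b : mcs x -> x (Or a b) <-> x a \/ x b.
Proof.
move=> mx; split=> [h|[]].
- case: (pselect (x a)) => ha; [by left|right].
  move/(mcs_neg mx) : ha; apply: mcs_L2 h => //; apply: L_taut => //; taut.
- by apply: mcs_LImp => //; apply: L_taut => //; taut.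
- by apply: mcs_LImp => //; apply: L_taut => //; taut.
Qed.

Lemma mcs_top x p : mcs x -> x (Top p).
Proof. by move=> mx; apply: (mcs_L mx); apply: L_taut => //; taut. Qed.

Lemma mcs_eq x y : mcs x -> mcs y -> x `<=` y -> x = y.
Proof.
move=> mx my xy; apply/seteqP; split=> // a ya; apply: contrapT => xa.
by move/(mcs_neg mx): xa => /xy/(mcs_neg my).
Qed.

(* [C] is an abstract notion of consistency with the conditions that the
   constructed set has to meet; [W] states whether witnesses are required. *)
Lemma lindenbaum (W : Prop) (C : form -> Prop) (a0 : form) :
  (forall a b, L (Imp a b) -> C a -> C b) ->
  (forall a, C a -> ~ L (Neg a)) ->
  (forall a b, C a -> C (And a b) \/ C (And a (Neg b))) ->
  (W -> forall a p b, C (And a (Ex p b)) ->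
     exists c, C (And a (subst (update Var p c) b))) ->
  C a0 -> exists x, [/\ mcs x, x a0, forall b, x b -> C b & W -> witnessed x].
Proof.
move=> Cmono Ccons Csplit Cwit Ca0.
(* From the formula built so far and the next one to decide, [c] is a strengthening of the former.
   Where witnesses are required, an accepted existential formula enters through an instance, which
   implies it. *)
have step (ab : form * form) : exists c, C ab.1 -> [/\ C c, L (Imp c ab.1) &
    (L (Imp c ab.2) /\ (W -> forall p b, ab.2 = Ex p b ->
                         exists d, L (Imp c (subst (update Var p d) b))))
    \/ L (Imp c (Neg ab.2))].
  case: ab => a b; case: (pselect (C a)) => [Ca|nC]; last by exists a => /= /nC.
  case: (Csplit a b Ca) => h; last first.
    exists (And a (Neg b)) => _; split=> //=; first by apply: L_taut => //; taut.
    by right; apply: L_taut => //; taut.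
  case: (pselect (W /\ exists p c, b = Ex p c)) => [[w [p [c bE]]]|nw].
    have := h; rewrite bE => /(Cwit w)[d hd].
    have hdb : L (Imp (subst (update Var p d) c) (Ex p c)) by apply: npqml_inst.
    exists (And a (subst (update Var p d) c)) => _; split=> //=.
      by apply: L_taut => //; taut.
    left; split=> [|_ q e [<- <-]]; first by apply: L_taut1 hdb _ => //; taut.
    exists d; by apply: L_taut => //; taut.
  exists (And a b) => _; split=> //=; first by apply: L_taut => //; taut.
  left; split=> [|w p c e]; first by apply: L_taut => //; taut.
  by case: nw; split=> //; exists p, c.
have {step} [g hg] := choice step.
have [e he] := form_enum.
(* Each stage is a single formula, stronger than the previous one; the set sought consists of the
   consequences of all stages. *)
pose s := fix s k := if k is k'.+1 then g (s k', e k') else a0.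
have Cs k : C (s k) by elim: k => //= k /(hg (s k, e k))[].
have sS k : L (Imp (s k.+1) (s k)) by have [] := hg (s k, e k) (Cs k).
have sle j k : j <= k -> L (Imp (s k) (s j)).
  move=> /subnK <-; elim: (k - j) => [|i IH]; first exact: L_refl.
  by rewrite addSn; apply: L_trans IH.
pose x : set form := [set b | exists k, L (Imp (s k) b)].
have xdec b : x b \/ x (Neg b).
  have [k <-] := he b; have [_ _ []] := hg (s k, e k) (Cs k).
    by case=> h _; left; exists k.+1.
  by right; exists k.+1.
have xC b : x b -> C b by case=> k /Cmono; apply.
have xcons b : x b -> x (Neg b) -> False.
  move=> [j hj] [k hk]; apply: (Ccons (s (maxn j k))) => //.
  apply: L_taut2 (L_trans HL (sle _ _ (leq_maxl j k)) hj)
    (L_trans HL (sle _ _ (leq_maxr j k)) hk) _ => //; taut.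
exists x; split=> //.
- split.
  + by move=> a La; exists 0; apply: L_taut1 La _ => //; taut.
  + move=> a b [j hj] [k hk]; exists (maxn j k).
    apply: L_taut2 (L_trans HL (sle _ _ (leq_maxl j k)) hj)
      (L_trans HL (sle _ _ (leq_maxr j k)) hk) _ => //; taut.
  + move=> a; split=> [h1 h2|na]; first exact: xcons h2 h1.
    by case: (xdec a).
- by exists 0; apply: L_refl.
move=> w p a xa; have [k ek] := he (Ex p a).
have [_ _ [[_ /(_ w p a ek)[d hd]]|h]] := hg (s k, e k) (Cs k).
  by exists d, k.+1.
by case: (xcons (Ex p a)) => //; exists k.+1; rewrite -ek.
Qed.

Lemma mcs_dia_cons x a : mcs x -> x (Dia a) -> ~ L (Neg a).
Proof.
by move=> mx xa /(L_Dia_false HL)/(mcs_L mx)/(mcs_neg mx).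
Qed.

Lemma mcs_dia_split x a b : mcs x -> x (Dia a) ->
  x (Dia (And a b)) \/ x (Dia (And a (Neg b))).
Proof.
move=> mx xa; apply: contrapT => h.
have [h1 h2] : ~ x (Dia (And a b)) /\ ~ x (Dia (And a (Neg b))).
  by split=> h'; apply: h; [left|right].
have xb c : x (Neg (Dia c)) -> x (Box (Neg c)).
  apply: mcs_LImp => //; apply: L_contra => //; apply: L_Dia => //.
  by apply: L_taut => //; taut.
move/(mcs_neg mx)/xb: h1 => h1; move/(mcs_neg mx)/xb: h2 => h2.
have h3 : x (Box (Neg a)).
  apply: (mcs_mp mx h2); apply: (mcs_LImp mx _ h1).
  apply: (L_trans HL _ (L_K HL _ _)); apply: L_Box => //.
  by apply: L_taut => //; taut.
move/(mcs_neg mx): h3; apply; apply: mcs_LImp xa => //; apply: L_Dia => //.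
by apply: L_taut => //; taut.
Qed.

(** Compactness for successors. If both ways of deciding a formula failed, at [g1] and at [g2], a
    member of [G] below both would contradict [mcs_dia_split]. *)
Lemma mcs_dia_dir x (G : form -> Prop) :
  mcs x -> (exists g, G g) ->
  (forall a b, G a -> G b -> exists c, [/\ G c, L (Imp c a) & L (Imp c b)]) ->
  (forall g, G g -> x (Dia g)) ->
  exists y, [/\ mcs y, canon_acc x y & G `<=` y].
Proof.
move=> mx [g0 Gg0] Gdir Gx.
pose C a := forall g, G g -> x (Dia (And a g)).
have [] := @lindenbaum False C (Top 0).
- move=> a b ab Ca g Gg; apply: mcs_LImp (Ca g Gg) => //; apply: L_Dia => //.
  by apply: L_taut1 ab _ => //; taut.
- move=> a Ca na; apply: (mcs_dia_cons mx (Ca g0 Gg0)).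
  by apply: L_taut1 na _ => //; taut.
- move=> a b Ca; apply: contrapT => h.
  have [/existsNP[g1 /not_implyP[G1 h1]] /existsNP[g2 /not_implyP[G2 h2]]] :
     ~ C (And a b) /\ ~ C (And a (Neg b)).
    by split=> h'; apply: h; [left|right].
  have [g [Gg l1 l2]] := Gdir _ _ G1 G2.
  case: (mcs_dia_split b mx (Ca g Gg)) => h3.
    apply: h1; apply: mcs_LImp h3 => //; apply: L_Dia => //.
    by apply: L_taut1 l1 _ => //; taut.
  apply: h2; apply: mcs_LImp h3 => //; apply: L_Dia => //.
  by apply: L_taut1 l2 _ => //; taut.
- by [].
- move=> g Gg; apply: mcs_LImp (Gx g Gg) => //; apply: L_Dia => //.
  by apply: L_taut => //; taut.
move=> y [my _ yC _]; exists y; split=> // [a /yC|g Gg].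
  move=> /(_ _ Gg0); apply: mcs_LImp => //; apply: L_Dia => //.
  by apply: L_taut => //; taut.
apply: contrapT => /(mcs_neg my)/yC/(_ g Gg)/(mcs_dia_cons mx); apply.
by apply: L_taut => //; taut.
Qed.

Lemma mcs_dia x a : mcs x -> x (Dia a) ->
  exists y, [/\ mcs y, canon_acc x y & y a].
Proof.
move=> mx xa; have [] := @mcs_dia_dir x (eq a) mx.
- by exists a.
- by move=> _ _ <- <-; exists a; split=> //; apply: L_refl.
- by move=> _ <-.
by move=> y [my xy ya]; exists y; split=> //; apply: ya.
Qed.

Lemma L_complete a : (forall x, mcs x -> x a) -> L a.
Proof.
move=> h; apply: contrapT => na.
have [] := @lindenbaum False (fun b => ~ L (Neg b)) (Neg a).
- by move=> b c bc nb nc; apply: nb; apply: L_taut2 bc nc _ => //; taut.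
- by [].
- move=> b c nb; apply: contrapT => /not_orP[/contrapT h1 /contrapT h2].
  by apply: nb; apply: L_taut2 h1 h2 _ => //; taut.
- by [].
- by move=> h1; apply: na; apply: L_taut1 h1 _ => //; taut.
by move=> x [mx /(mcs_neg mx) xa _ _]; apply: xa; apply: h.
Qed.

(* The step from [Dia (a /\ Ex p b)] to a witness uses the Barcan formula at
   the world [x], where the witness is already available. *)
Lemma mcs_dia_witnessed x a : Bc `<=` L -> mcs x -> witnessed x -> x (Dia a) ->
  exists y, [/\ mcs y, witnessed y, canon_acc x y & y a].
Proof.
move=> HBc mx wx xa.
have [] := @lindenbaum True (fun b => x (Dia b)) a.
- by move=> b c bc; apply: mcs_LImp => //; apply: L_Dia.
- by move=> b; apply: mcs_dia_cons.
- by move=> b c; apply: mcs_dia_split.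
(* Renaming the bound variable to [q], not free in [b], lets the quantifier be pulled out of the
   conjunction before the Barcan formula moves it across [Dia]. *)
- move=> _ b p c h; pose q := first_notin (Fv (Ex p c) ++ Fv b).
  have := first_notinP (Fv (Ex p c) ++ Fv b);
    rewrite -/q mem_cat negb_or => /andP[qc qb].
  pose c' := subst (update Var p (Var q)) c.
  have h1 : L (Imp (Ex q c') (Imp b (Ex q (And b c')))).
    apply: npqml_exE HL _ _ _ _ _.
      have h2 := L_Ex_intro HL q (And b c'); apply: L_taut1 h2 _ => //; taut.
    by rewrite /Imp -/(Imp _ _) /= mem_cat mem_filter eqxx (negbTE qb).
  have h2 := L_Ex_rename HL qc.
  have : x (Dia (Ex q (And b c'))).
    apply: mcs_LImp h => //; apply: L_Dia => //; apply: L_taut2 h1 h2 _ => //; taut.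
  have hBc : L (Imp (Dia (Ex q (And b c'))) (Ex q (Dia (And b c')))).
    by apply: HBc; exists q, (And b c').
  move=> /(mcs_LImp mx hBc)/wx[d].
  rewrite /= (subst_update_notin _ qb) => hd.
  exists d; apply: mcs_LImp hd => //; apply: L_Dia => //.
  have [|h3 _] := @subst_subst1 L HL Var p q c d.
    by move=> r hr; rewrite inE; apply: contraNneq qc => ->.
  by apply: L_taut1 h3 _ => //; taut.
- by [].
by move=> y [my ya yx wy]; exists y; split=> //; apply: wy.
Qed.

End Mcs.

(** * Sahlqvist persistence *)

Lemma signed_qf b a : signed b a -> quantifier_free a.
Proof. by elim=> //= ? ? ? _ ? _ ?; split. Qed.

Section Sahlqvist.
Variable F : frame.
Implicit Types (U V : nat -> set F) (l : seq (nat * nat * F)).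

Local Notation sat V a x := (gsem setT V a x).

Lemma signed_mono b a U V x : signed b a -> (forall p, U p `<=` V p) ->
  sat (if b then U else V) a x -> sat (if b then V else U) a x.
Proof.
move=> sa UV; elim: sa x => {b a}.
- by move=> p x /=; apply: UV.
- move=> b p x _ /=; set X := (if b then V else U) p.
  by case: (pselect (X x)); [left|right].
- by move=> [] a _ IH x /= h /IH.
- by move=> b a c _ IHa _ IHc x /= [/IHa|/IHc]; [left|right].
- by move=> b a _ IH x /= [y /IH hy xy]; exists y.
Qed.

Lemma positive_mono a U V x : positive a -> (forall p, U p `<=` V p) ->
  sat U a x -> sat V a x.
Proof. by move=> pa UV; apply: (signed_mono (x := x) pa UV). Qed.

Lemma negative_mono a U V x : negative a -> (forall p, U p `<=` V p) ->
  sat V a x -> sat U a x.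
Proof. by move=> pa UV; apply: (signed_mono (x := x) pa UV). Qed.

(* The minimal valuations of the Sahlqvist-van Benthem argument: a triple
   [(p, k, x)] in [l] puts the [k]-step successors of [x] into [p]. *)
Definition min_val l : nat -> set F :=
  fun p => [set y | exists k x, List.In (p, k, x) l /\ racc k x y].

Lemma min_val_cat l l' p :
  min_val (l ++ l') p = min_val l p `|` min_val l' p.
Proof.
apply/seteqP; split=> y.
  by move=> [k [x [/List.in_app_iff[] h xy]]]; [left|right]; exists k, x.
by move=> [] [k [x [h xy]]]; exists k, x; split=> //; apply/List.in_app_iff;
  [left|right].
Qed.

Definition all_sat V (N : seq (form * F)) : Prop :=
  forall a y, List.In (a, y) N -> sat V a y.

Lemma all_sat_cat V N N' : all_sat V (N ++ N') <-> all_sat V N /\ all_sat V N'.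
Proof.
split=> [h|[h h'] a y /List.in_app_iff[/h|/h']//].
by split=> a y ay; apply: h; apply/List.in_app_iff; [left|right].
Qed.

(** A true antecedent has a finite certificate: [l] lists the boxed atoms used and [N] the negative
    formulas, each with its world. Disjunctions are settled by the true disjunct, so no normal form
    is required. *)
Lemma antecedent_min a V x : sahlqvist_antecedent a -> sat V a x ->
  exists l N, [/\ forall p, min_val l p `<=` V p,
    forall b y, List.In (b, y) N -> negative b, all_sat V N &
    forall U, (forall p, min_val l p `<=` U p) -> all_sat U N -> sat U a x].
Proof.
move=> sa; elim: sa x => {a}.
- move=> k p x /gsem_BoxN h; exists [:: (p, k, x)], [::]; split=> //.
    by move=> q y [j [z [[]]]] // [<- <- <-]; apply: h.
  move=> U hU _; apply/gsem_BoxN => u xu; apply: hU.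
  by exists k, x; split=> //; left.
- move=> a na x ax; exists [::], [:: (a, x)]; split=> //.
  + by move=> p y [k [z [[]]]].
  + by move=> b y [[<- _]|[]].
  + by move=> b y [[<- <-]|[]].
  + by move=> U _; apply; left.
- move=> a b _ IHa _ IHb x /gsem_And[/IHa[l [N [h1 h2 h3 h4]]] /IHb[l' [N' [h1' h2' h3' h4']]]].
  exists (l ++ l'), (N ++ N'); split.
  + by move=> p; rewrite min_val_cat subUset; split.
  + by move=> c y /List.in_app_iff[/h2|/h2'].
  + by apply/all_sat_cat.
  + move=> U hU /all_sat_cat[hN hN']; apply/gsem_And.
    by split; [apply: h4|apply: h4'] => // p; have := hU p;
      rewrite min_val_cat subUset => -[].
- move=> a b _ IHa _ IHb x /gsem_Or[/IHa|/IHb] [l [N [h1 h2 h3 h4]]].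
    by exists l, N; split=> // U hU hN; apply/gsem_Or; left; apply: h4.
  by exists l, N; split=> // U hU hN; apply/gsem_Or; right; apply: h4.
- move=> a _ IH x [y /IH[l [N [h1 h2 h3 h4]]] xy]; exists l, N.
  by split=> // U hU hN; exists y => //; apply: h4.
Qed.

Variable B : set (set F).
Hypothesis BT : B setT.
Hypothesis BI : forall X Y, B X -> B Y -> B (X `&` Y).
(** The two applications differ here: on the canonical frame this is Esakia's lemma, while on the
    frame of atoms [min_val l] is itself admissible. *)
Hypothesis tight : forall l a x, negative a -> sat (min_val l) a x ->
  exists U, [/\ forall p, B (U p), forall p, min_val l p `<=` U p & sat U a x].

(** The valuations obtained for the single formulas are intersected: the result still lies above
    [min_val l], and negative formulas survive shrinking. *)
Lemma tight_seq l N :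
  (forall b y, List.In (b, y) N -> negative b) -> all_sat (min_val l) N ->
  exists U, [/\ forall p, B (U p), forall p, min_val l p `<=` U p & all_sat U N].
Proof.
elim: N => [|[a x] N IH] hN hs; first by exists (fun=> setT); split.
have [||U [BU hU sU]] := IH; first by move=> b y h; apply: (hN b y); right.
  by move=> b y h; apply: hs; right.
have na : negative a by apply: (hN a x); left.
have [|U' [BU' hU' sU']] := @tight l a x na; first by apply: hs; left.
exists (fun p => U p `&` U' p); split.
- by move=> p; apply: BI.
- by move=> p; rewrite subsetI; split.
move=> b y [[<- <-]|h]; first by apply: negative_mono sU' => // p z [].
have nb : negative b by apply: (hN b y); right.
by apply: negative_mono (sU _ _ h) => // p z [].
Qed.

Lemma sahlqvist_refute a V x : sahlqvist a -> ~ sat V a x ->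
  exists2 U, forall p, B (U p) & ~ sat U a x.
Proof.
move=> sa; elim: sa x => {a}.
- move=> a b sa pb x; rewrite gsem_Imp => /not_implyP[ax nbx].
  have [l [N [h1 h2 h3 h4]]] := antecedent_min sa ax.
  (* The refuted positive consequent joins the certificate as one more negative formula. *)
  have [||U [BU hU sU]] := @tight_seq l ((Neg b, x) :: N).
  + by move=> b' y [[<- _]|/h2//]; apply: (@signed_Neg true).
  + move=> b' y [[<- <-] /=|h]; first by apply: contra_not nbx; apply: positive_mono.
    by apply: negative_mono (h3 _ _ h) => //; apply: h2 h.
  exists U => //; rewrite gsem_Imp => h; have nb := sU (Neg b) x (or_introl erefl).
  by apply/nb/h/h4 => // c z cz; apply: sU; right.
- move=> a _ IH x; rewrite gsem_Box => /existsNP[y /not_implyP[xy /IH[U BU h]]].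
  by exists U => //; rewrite gsem_Box => /(_ y xy).
- move=> a b _ IHa _ IHb x; rewrite gsem_And => /not_andP[/IHa|/IHb] [U BU h];
  by exists U => //; rewrite gsem_And => -[].
- move=> a b _ IHa _ IHb ab x; rewrite gsem_Or => /not_orP[/IHa[U BU hU] /IHb[U' BU' hU']].
  (* The disjuncts share no free variable, so the two refuting valuations can be glued. *)
  exists (fun p => if p \in Fv a then U p else U' p) => [p|]; first by case: ifP.
  rewrite gsem_Or (gsem_ext _ (v' := U)) => [|p ->//].
  rewrite (gsem_ext _ (v' := U') (a := b)) => [[]//|p pb].
  by case: ifP => // /ab; rewrite pb.
Qed.

Lemma sahlqvist_persistent a : sahlqvist a ->
  (forall U, (forall p, B (U p)) -> sem U a = setT) -> valid F a.
Proof.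
move=> sa h V; rewrite -subTset => x _; rewrite -gsemT; apply: contrapT.
by move=> /(sahlqvist_refute sa)[U BU]; rewrite gsemT h //; apply.
Qed.

End Sahlqvist.

(** * The canonical frame *)

Section Canonical.
Variables (L : set form) (HL : npqml L).

Local Notation mcs := (mcs L).

(* Not [{x : set form | mcs x}]: the universe of [set] lies above that of the
   worlds of a [frame]. *)
Definition mcs_type := {x : form -> Prop | mcs x}.

Definition canonical_frame (i : inhabited mcs_type) : frame :=
  @Frame mcs_type (fun x y => canon_acc (sval x) (sval y)) i.

Variable i : inhabited mcs_type.
Local Notation Fc := (canonical_frame i).

Definition ext_val (s : nat -> form) : nat -> set Fc :=
  fun p => [set x | sval x (s p)].

Lemma canonical_truth B s a (x : Fc) : quantifier_free a ->
  gsem B (ext_val s) a x <-> sval x (subst s a).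
Proof.
elim: a x => [p|a IH|a IHa b IHb|a IH|p a IH] //= x.
- by move=> /IH h; rewrite (mcs_neg (svalP x)); apply: not_iff_compat; apply: h.
- move=> [/IHa ha /IHb hb]; rewrite (mcs_or HL _ _ (svalP x)).
  by split=> -[/ha|/hb]; [left|right|left|right].
move=> /IH ha; split=> [[y /ha hy xy]|]; first exact: xy.
move=> /(mcs_dia HL (svalP x))[y [my xy ya]].
by exists (exist _ y my) => //; apply/ha.
Qed.

(** The path is built from its end: the formulas [DiaN k a] with [a] in [y] are directed, and a
    successor of [x] containing all of them is the next world. *)
Lemma racc_canonical k (x y : Fc) :
  (forall a, sval y a -> sval x (DiaN k a)) -> racc k x y.
Proof.
elim: k x => [|k IH] x h.
  case: x y h => [x mx] [y my] /= h.
  have e : y = x by apply: (mcs_eq my mx).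
  by case: _ / e in mx h *; congr (exist _ _ _).
have [] := @mcs_dia_dir L HL (sval x) [set g | exists2 a, sval y a & g = DiaN k a] (svalP x).
- by exists (DiaN k (Top 0)), (Top 0) => //; apply: mcs_top (svalP y).
- move=> _ _ [a ya ->] [b yb ->]; exists (DiaN k (And a b)); split.
  + by exists (And a b) => //; apply/(mcs_and HL _ _ (svalP y)).
  + by apply: L_DiaN => //; apply: L_taut => //; taut.
  + by apply: L_DiaN => //; apply: L_taut => //; taut.
- by move=> _ [a ya ->]; apply: h.
move=> z [mz xz Gz]; exists (exist _ z mz) => //; apply: IH => a ya.
by apply: Gz; exists a.
Qed.

Lemma signed_L b a s t : signed b a -> (forall p, L (Imp (s p) (t p))) ->
  L (if b then Imp (subst s a) (subst t a) else Imp (subst t a) (subst s a)).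
Proof.
move=> + st; elim=> {b a} /=.
- by move=> p; apply: st.
- by move=> [] p; apply: L_taut => //; taut.
- by move=> [] a _ /=; apply: L_contra.
- by move=> [] a c _ h1 _ h2; apply: L_taut2 h1 h2 _ => //; taut.
- by move=> [] a _; apply: L_Dia.
Qed.

Section Esakia.
Variable l : seq (nat * nat * Fc).

Definition above (s : nat -> form) : Prop :=
  forall p, min_val l p `<=` ext_val s p.

Lemma above_dir s t : above s -> above t ->
  above (fun p => And (s p) (t p)).
Proof.
move=> hs ht p y hy; apply/(mcs_and HL _ _ (svalP y)).
by split; [apply: hs|apply: ht].
Qed.

Lemma above_top : above (fun=> Top 0).
Proof. by move=> p y _; apply: mcs_top (svalP y). Qed.

(** Topologically, a minimal valuation is a finite union of closed sets. If [y] is outside, each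
    triple [(p, k, x)] yields some [a] in [y] with [DiaN k a] not in [x]; the disjunction of the
    formulas [Neg a] covers the union and fails at [y]. *)
Lemma above_closed p (y : Fc) : (forall s, above s -> ext_val s p y) -> min_val l p y.
Proof.
move=> h; apply: contrapT => ny.
suff [c hc nc] : exists2 c, (forall z, min_val l p z -> sval z c) & ~ sval y c.
  apply: nc; have := h (update (fun=> Top 0) p c); rewrite /ext_val /= updE; apply.
  move=> q z hz; rewrite /ext_val /= /update; case: eqP => [e|_].
    by apply: hc; rewrite -e.
  exact: mcs_top (svalP z).
elim: l ny => [|[[q k] x] l' IH] ny.
  exists (Neg (Top 0)) => [z [k [x [[]]]]|].
  by move/(mcs_neg (svalP y)); apply; apply: mcs_top (svalP y).
have [|c hc nc] := IH.
  by apply: contra_not ny => -[j [z [jz zy]]]; exists j, z; split=> //; right.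
case: (pselect (q = p)) => [qp|qp]; last first.
  by exists c => // z [j [u [[[/qp//]|hu] uz]]]; apply: hc; exists j, u.
have [a [ya na]] : exists a, sval y a /\ ~ sval x (DiaN k a).
  apply: contrapT => hn; apply: ny; exists k, x; split; first by left; rewrite qp.
  apply: racc_canonical => a ya; apply: contrapT => na; apply: hn; by exists a.
exists (Or c (Neg a)); last first.
  by move/(mcs_or HL _ _ (svalP y)) => -[//|/(mcs_neg (svalP y))].
move=> z [j [u [hu uz]]]; apply/(mcs_or HL _ _ (svalP z)).
case: hu => [[_ jk ux]|hu]; last by left; apply: hc; exists j, u.
right; apply/(mcs_neg (svalP z)); rewrite -jk -ux in uz; apply: contra_not na => za.
elim: k x uz {ny jk ux} => [|k IHk] x /=; first by move=> ->.
by move=> [x' xx' /IHk]; apply: xx'.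
Qed.

(* Esakia's lemma: the value of a positive formula at a closed valuation is the
   intersection of its values at the definable valuations above it. *)
Lemma esakia b a (x : Fc) : signed b a ->
  (forall s, above s ->
     if b then sval x (subst s a) else ~ sval x (subst s a)) ->
  if b then gsem setT (min_val l) a x else ~ gsem setT (min_val l) a x.
Proof.
move=> sa; elim: sa x => {b a}.
- by move=> p x; apply: above_closed.
- move=> [] p x; last first.
    by move=> /(_ _ above_top) h; case: h; apply: (mcs_L (svalP x));
      apply: L_taut => //=; taut.
  by move=> _ /=; case: (pselect (min_val l p x)); [left|right].
- move=> [] a sa IH x /= h.
    move=> nh; apply: nh; apply: IH => s /h hs; apply: contrapT => na.
    by apply: hs; apply/(mcs_neg (svalP x)).
  by apply: IH => s /h /(mcs_neg (svalP x)).
- move=> [] a c sa IHa sc IHc x /= h; last first.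
    move=> []; [apply: IHa|apply: IHc] => s /h hs hx; apply: hs.
      by apply/(mcs_or HL _ _ (svalP x)); left.
    by apply/(mcs_or HL _ _ (svalP x)); right.
  apply: contrapT => nac.
  have [s1 hs1 n1] : exists2 s, above s & ~ sval x (subst s a).
    apply: contrapT => hn; apply: nac; left; apply: IHa => s hs.
    by apply: contrapT => ns; apply: hn; exists s.
  have [s2 hs2 n2] : exists2 s, above s & ~ sval x (subst s c).
    apply: contrapT => hn; apply: nac; right; apply: IHc => s hs.
    by apply: contrapT => ns; apply: hn; exists s.
  have := h _ (above_dir hs1 hs2) => /(mcs_or HL _ _ (svalP x))[ha|hc].
    apply: n1; apply: (mcs_LImp (svalP x) _ ha).
    by apply: (signed_L sa) => p; apply: L_taut => //; taut.
  apply: n2; apply: (mcs_LImp (svalP x) _ hc).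
  by apply: (signed_L sc) => p; apply: L_taut => //; taut.
- move=> [] a sa IH x /= h; last first.
    move=> [y hy xy]; move: hy; apply: IH => s /h; apply: contra_not; exact: xy.
  (* Here [a] is positive, so by monotonicity the meet of two valuations gives a common lower bound:
     the family is directed, and one successor contains all of it. *)
  have [] := @mcs_dia_dir L HL (sval x) [set g | exists2 s, above s & g = subst s a] (svalP x).
  + by exists (subst (fun=> Top 0) a), (fun=> Top 0) => //; apply: above_top.
  + move=> _ _ [s hs ->] [t ht ->].
    exists (subst (fun p => And (s p) (t p)) a); split.
    * by exists (fun p => And (s p) (t p)) => //; apply: above_dir.
    * by apply: (signed_L sa) => p; apply: L_taut => //; taut.
    * by apply: (signed_L sa) => p; apply: L_taut => //; taut.
  + by move=> _ [s /h hs ->].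
  move=> y [my xy Gy]; exists (exist _ y my) => //; apply: IH => s hs.
  by apply: Gy; exists s.
Qed.

End Esakia.

Lemma canonical_sahlqvist a : sahlqvist a -> quantifier_free a -> L a ->
  valid Fc a.
Proof.
move=> sa qa La.
pose B : set (set Fc) := [set X | exists c, X = [set x | sval x c]].
apply: (@sahlqvist_persistent _ B) => //.
- by exists (Top 0); apply/seteqP; split=> // x _; apply: mcs_top (svalP x).
- move=> _ _ [c ->] [d ->]; exists (And c d).
  by apply/seteqP; split=> x /(mcs_and HL _ _ (svalP x)).
- move=> l b x nb hx.
  have [s hs bs] : exists2 s, above l s & sval x (subst s b).
    apply: contrapT => hn; suff : ~ gsem setT (min_val l) b x by [].
    by apply: (esakia nb) => s hs hb; apply: hn; exists s.
  exists (ext_val s); split=> //; first by move=> p; exists (s p).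
  by apply/canonical_truth => //; apply: signed_qf nb.
- move=> U BU; have [s hs] := choice BU.
  have -> : U = ext_val s by apply/funext => p; rewrite hs.
  rewrite -gsemT -subTset => x _; apply/canonical_truth => //.
  by apply: (mcs_L (svalP x)); apply: L_subst.
Qed.

End Canonical.

(** * Diversity *)

Section Swap.
Variable T : Type.
Implicit Types x y z : T.

Lemma swapL x y : swap x y x = y.
Proof. by rewrite /swap asboolT. Qed.

Lemma swapR x y : swap x y y = x.
Proof.
rewrite /swap; case: (pselect (y = x)) => [->|yx]; first by rewrite asboolT.
by rewrite asboolF // asboolT.
Qed.

Lemma swapD x y z : z <> x -> z <> y -> swap x y z = z.
Proof. by move=> zx zy; rewrite /swap !asboolF. Qed.

End Swap.

Section Duplicates.
Variable F : frame.
Implicit Types x y z : F.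

Lemma duplicates_refl x : duplicates x x.
Proof.
have e z : swap x x z = z.
  by rewrite /swap; case: asboolP => [->|].
by split=> [|y z]; [exists id => y; rewrite /= e|rewrite !e].
Qed.

Lemma duplicates_accR x y z : duplicates x y -> z <> x -> z <> y ->
  acc z x <-> acc z y.
Proof. by move=> [_ h] zx zy; have := h z x; rewrite swapL swapD // => ->. Qed.

Lemma duplicates_accL x y z : duplicates x y -> z <> x -> z <> y ->
  acc x z <-> acc y z.
Proof. by move=> [_ h] zx zy; have := h x z; rewrite swapL swapD // => ->. Qed.

Lemma duplicates_accC x y : duplicates x y -> acc x y <-> acc y x.
Proof. by move=> [_ h]; have := h x y; rewrite swapL swapR => ->. Qed.

Lemma duplicate_color n : (duplicate_classes F #<= `I_n)%card ->
  exists2 c : F -> nat, forall x, c x < n &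
    forall x y, c x = c y -> duplicates x y.
Proof.
case/pcard_leP => f.
have cl x : duplicate_classes F [set u | duplicates x u] by exists x.
exists (fun x => f [set u | duplicates x u]) => [x|x y e].
  exact: (@funS _ _ _ _ f _ (cl x)).
have /(_ _ _ (mem_set (cl x)) (mem_set (cl y)) e) := 'inj_f.
by rewrite predeqE => /(_ y)[_]; apply; apply: duplicates_refl.
Qed.

End Duplicates.

Lemma pigeonhole n (c : nat -> nat) : (forall i, i <= n -> c i < n) ->
  exists i j, [/\ i < j, j <= n & c i = c j].
Proof.
move=> cn; have : ~~ uniq (map c (iota 0 n.+1)).
  apply/negP => u; suff : n.+1 <= n by rewrite ltnn.
  have := @uniq_leq_size _ _ (iota 0 n) u; rewrite size_map !size_iota;
    apply=> x /mapP[i].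
  by rewrite !mem_iota add0n ltnS => /cn ic ->.
move=> /(uniqPn 0)[i [j [ij]]]; rewrite size_map size_iota ltnS => jn.
have iN : i < n.+1 by apply: ltn_trans ij _.
rewrite !(nth_map 0) ?size_iota // !nth_iota // !add0n => e.
by exists i, j.
Qed.

Section Diversity.
Variable F : frame.
Implicit Types x y z : F.

Lemma racc_trans k l x y z : racc k x y -> racc l y z -> racc (k + l) x z.
Proof.
elim: k x => [|k IH] x /=; first by move=> ->.
by move=> [u xu uy] yz; exists u => //; apply: IH.
Qed.

Lemma racc_clos k x y : racc k x y -> clos_refl_trans F (@acc F) x y.
Proof.
elim: k x => [|k IH] x /=; first by move=> ->; apply: rt_refl.
by move=> [u xu /IH uy]; apply: rt_trans uy; apply: rt_step.
Qed.

Lemma racc_path k x y : racc k x y -> exists g : nat -> F,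
  [/\ g 0 = x, g k = y & forall i, i < k -> acc (g i) (g i.+1)].
Proof.
elim: k x => [|k IH] x; first by move=> <-; exists (fun=> x).
move=> [u xu /IH[g [g0 gk gS]]].
exists (fun i => if i is i'.+1 then g i' else x); split=> // -[|i] //= ik.
  by rewrite g0.
exact: gS.
Qed.

Lemma path_racc (g : nat -> F) k i j : (forall i, i < k -> acc (g i) (g i.+1)) ->
  i <= j -> j <= k -> racc (j - i) (g i) (g j).
Proof.
move=> gS /subnK <-; rewrite addnK; move: (j - i) => m; elim: m i => [|m IH] i //=.
rewrite addSn => mk; exists (g i.+1); last by rewrite -addnS; apply: IH; rewrite addnS.
by apply: gS; apply: leq_ltn_trans mk; rewrite leq_addl.
Qed.

(* On a shortest path the worlds after the first one are never duplicates:
   exchanging two of them would give a shortcut. *)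
Lemma diversity_bounded n k x y :
  (duplicate_classes (generated_subframe x) #<= `I_n)%card ->
  racc k x y -> exists2 j, j <= n & racc j x y.
Proof.
move=> /duplicate_color[c cn cdup] xy.
have [d xyd dmin] : exists2 d, racc d x y & forall j, racc j x y -> d <= j.
  have h : exists d, `[< racc d x y >] by exists k; apply/asboolP.
  have [d /asboolP h1 h2] := ex_minnP h.
  by exists d => // j jxy; apply: h2; apply/asboolP.
exists d => //; rewrite leqNgt; apply/negP => nd.
have [g [g0 gd gS]] := racc_path xyd.
have gx i : racc (minn i d) x (g (minn i d)).
  by have := path_racc gS (leq0n (minn i d)) (geq_minr i d); rewrite subn0 g0.
have gmin j m : m <= d -> racc j x (g m) -> m <= j.
  move=> md /racc_trans/(_ (path_racc gS md (leqnn d))); rewrite gd => /dmin.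
  by rewrite -(leq_add2r (d - m) m j) subnKC.
pose G := generated_subframe x.
(* [minn] makes [h] total; up to index [d] it is the path itself. *)
pose h i : G := exist _ (g (minn i d)) (racc_clos (gx i)).
(* Two of the [n.+1] worlds from [h 1] to [h n.+1] share a colour. The shift leaves out [h 0], since
   the shortcut starts at the predecessor of the earlier duplicate. *)
have [|i [j [ij jn e]]] := @pigeonhole n (fun i => c (h i.+1)); first by move=> i _;
  apply: cn.
have jd : j < d by apply: leq_ltn_trans nd.
have id : i < d by apply: ltn_trans jd.
have hE m : m <= d -> sval (h m) = g m by move=> /minn_idPl /= ->.
have hneq m m' : m < m' -> m' <= d -> h m <> h m'.
  move=> mm' m'd /(congr1 sval); rewrite !hE //; last by apply: ltnW (leq_trans mm' _).
  move=> gg; have mmd : m <= d by apply: ltnW (leq_trans mm' _).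
  have := @gmin m m' m'd; rewrite -gg => /(_ _).
  have := gx m; rewrite (minn_idPl mmd) => gm /(_ gm).
  by rewrite leqNgt mm'.
have : @acc G (h i) (h i.+1) by rewrite /= !(minn_idPl _) //; [apply: gS|apply: ltnW].
move=> /(duplicates_accR (cdup _ _ e)) => /(_ _ _) hij.
have : @acc G (h i) (h j.+1) by apply: hij; apply: hneq => //; apply: ltnW.
rewrite /= !(minn_idPl _) //; last by apply: ltnW.
have := gx i; rewrite (minn_idPl (ltnW id)) => gi /(raccS gi)/gmin.
by move=> /(_ jd); rewrite ltnS leqNgt ij.
Qed.

End Diversity.

Lemma sval_inj (T : Type) (P : T -> Prop) : injective (@sval T P).
Proof. by move=> [x px] [y py] /= xy; apply: eq_exist. Qed.

(** * General frames and their atoms *)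

Section GeneralFrame.
Variables (F : frame) (B : set (set F)).
Hypothesis closed : forall v a, (forall p, B (v p)) -> B (gsem B v a).

Lemma closedC X : B X -> B (~` X).
Proof. by move=> BX; apply: (@closed (fun=> X) (Neg (Var 0))). Qed.

Lemma closedU X Y : B X -> B Y -> B (X `|` Y).
Proof.
move=> BX BY; apply: (@closed (fun p => if p == 0 then X else Y) (Or (Var 0) (Var 1))).
by move=> p; case: ifP.
Qed.

Lemma closedI X Y : B X -> B Y -> B (X `&` Y).
Proof. by move=> BX BY; rewrite -[_ `&` _]setCK setCI; apply/closedC/closedU;
  apply: closedC. Qed.

Lemma closed_pre X : B X -> B [set x | exists2 y, X y & acc x y].
Proof. by move=> BX; apply: (@closed (fun=> X) (Dia (Var 0))). Qed.

Lemma closedT X : B X -> B setT.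
Proof. by move=> BX; rewrite -(setUCr X); apply: closedU => //; apply: closedC. Qed.

End GeneralFrame.

Section Atoms.
Variables (F : frame) (B : set (set F)) (n : nat) (w0 : F) (v0 : nat -> set F).
Hypothesis closed : forall v a, (forall p, B (v p)) -> B (gsem B v a).
Hypothesis Bv0 : forall p, B (v0 p).
Hypothesis separated : forall x y, (forall X, B X -> X x -> X y) -> x = y.
(** This makes [DiaLe n] at [w0] a global modality for admissible sets, so that the axioms, assumed
    at [w0] only, govern the whole frame. *)
Hypothesis reach : forall X x, B X -> X x ->
  exists j y, [/\ j <= n, racc j w0 y & X y].
Hypothesis w0_At : gsem B v0 (At n) w0.
Hypothesis w0_Rax : gsem B v0 (Rax n) w0.

Let BC := closedC closed.
Let BI := closedI closed.

(** If an admissible [D] contained [y] but missed another point of [Y], then [Y] without [D] would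
    be met within [n] steps, where [Y] is decided to lie inside [D]. *)
Let decided_singleton Y y : B Y -> Y y ->
  (exists2 j, j <= n & racc j w0 y) ->
  (forall Z, B Z ->
        (forall j u, j <= n -> racc j w0 u -> Y u -> Z u) \/
        (forall j u, j <= n -> racc j w0 u -> Y u -> ~ Z u)) ->
  Y = [set y].
Proof.
move=> BY Yy [j jn wy] dec; apply/seteqP; split=> [z Yz|_ -> //].
apply/esym/separated => D BD Dy; apply: contrapT => nDz.
case: (dec D BD) => [h|/(_ j y jn wy Yy)//].
have [i [u [iN wu [Yu nDu]]]] := reach (BI BY (BC BD)) (conj Yz nDz).
exact/nDu/(h i).
Qed.

Lemma atomic X x : B X -> X x -> exists2 y, B [set y] & X y.
Proof.
move=> BX Xx; move/gsem_At: w0_At => /(_ X BX (reach BX Xx)).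
move=> [Y [BY [j [y [jn wy Yy]]] dec YX]]; exists y; last exact: YX wy Yy.
by rewrite -(@decided_singleton Y y) //; exists j.
Qed.

(* [Rax] provides the least admissible superset of the image of [X], which
   agrees with the image on atoms only. *)
Lemma image X : B X -> exists Y, [/\ B Y,
  forall x y, X x -> acc x y -> Y y &
  forall y, B [set y] -> Y y -> exists2 x, X x & acc x y].
Proof.
move=> BX; move/gsem_Rax: w0_Rax => /(_ X BX)[Y BY [h1 h2]]; exists Y; split=> //.
- move=> x y Xx xy; apply: contrapT => nYy.
  have Bp := closed_pre closed (BC BY).
  have [|j [u [jn wu [Xu [z nYz uz]]]]] := reach (BI BX Bp) (x := x).
    by split=> //; exists y.
  exact/nYz/(h1 j u).
move=> y By Yy; apply: contrapT => ny.
have [j [z [jn + zy]]] := reach By (erefl : [set y] y).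
rewrite (zy : z = y) => wy; apply: (h2 _ (BC By) _ j y jn wy Yy erefl) => i u _ _ Xu t ut /= ty.
by apply: ny; exists u => //; rewrite -ty.
Qed.

(** The set [Y] given by [image] for the atom [x] contains [y], so [X] and [Y] share an atom; as [Y]
    is exact on atoms, that atom is a true successor. *)
Lemma atomic_dia X x y : B [set x] -> B X -> X y -> acc x y ->
  exists z, [/\ B [set z], X z & acc x z].
Proof.
move=> Bx BX Xy xy; have [Y [BY h1 h2]] := image Bx.
have [|z Bz [Xz Yz]] := atomic (BI BX BY) (x := y).
  by split=> //; apply: h1 xy.
by exists z; split=> //; have [_ ->] := h2 z Bz Yz.
Qed.

(* Otherwise the formula "I am not an atom" would hold somewhere, hence at some
   atom. *)
Lemma root_atom : B [set w0].
Proof.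
pose d := Ex 0 (And (Var 0) (Q n (Var 0))).
have Bd : B (gsem B v0 d) by apply: closed.
case: (pselect (gsem B v0 d w0)) => [/gsem_Ex[X BX /gsem_And[Xw /gsem_Q[_ dec]]]|nd].
  by rewrite -(@decided_singleton X w0) //; exists 0.
have [x Bx] := atomic (BC Bd) nd; case; apply/gsem_Ex; exists [set x] => //.
apply/gsem_And; split=> //; apply/gsem_Q; split; first by exists 0, x.
by move=> X BX; case: (pselect (X x)) => h; [left|right] => j u _ _ ->.
Qed.

Definition atom_frame : frame :=
  @Frame {x : F | B [set x]} (fun x y => acc (sval x) (sval y))
    (inhabits (exist _ w0 root_atom)).

Local Notation FA := atom_frame.

Definition atom_trace (X : set F) : set FA := [set x | X (sval x)].

Definition atom_sets : set (set FA) :=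
  [set X | exists2 Y, B Y & X = atom_trace Y].

Lemma atom_gsem v a (x : FA) : (forall p, B (v p)) ->
  gsem atom_sets (fun p => atom_trace (v p)) a x <-> gsem B v a (sval x).
Proof.
elim: a v x => [p|a IH|a IHa b IHb|a IH|p a IH] v x Bv //.
- by apply: not_iff_compat; apply: IH.
- by rewrite !gsem_Or IHa // IHb.
- split=> [[y /(IH _ _ Bv) hy xy]|[y hy xy]]; first by exists (sval y).
  have [z [Bz hz xz]] := atomic_dia (svalP x) (closed _ Bv) hy xy.
  by exists (exist _ z Bz) => //; apply/IH.
have Bu X : B X -> forall q, B (update v p X q).
  by move=> BX q; rewrite /update; case: eqP.
rewrite !gsem_Ex; split=> [[_ [X BX ->]]|[X BX h]].
  by rewrite -(upd_comp atom_trace) => /(IH _ _ (Bu X BX)) h; exists X.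
exists (atom_trace X); first by exists X.
by rewrite -(upd_comp atom_trace); apply/IH => //; apply: Bu.
Qed.

Lemma atom_sets_val (v : nat -> set FA) : (forall p, atom_sets (v p)) ->
  exists2 u, forall p, B (u p) & v = fun p => atom_trace (u p).
Proof.
move=> h; have h' p : exists Y, B Y /\ v p = atom_trace Y by have [Y] := h p; exists Y.
by have [u hu] := choice h'; exists u => [p|]; [case: (hu p)|apply/funext => p;
  case: (hu p)].
Qed.

Lemma atom_closed v a : (forall p, atom_sets (v p)) ->
  atom_sets (gsem atom_sets v a).
Proof.
move=> /atom_sets_val[u Bu ->]; exists (gsem B u a); first exact: closed.
by apply/seteqP; split=> x; have := atom_gsem a x Bu; case=> h1 h2.
Qed.

Lemma atom_singleton (x : FA) : atom_sets [set x].
Proof.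
exists [set sval x]; first exact: (svalP x).
apply/seteqP; split=> [_ -> //|y yx].
exact: (@sval_inj F (fun x => B [set x]) y x yx).
Qed.

Lemma atom_image X : atom_sets X -> atom_sets [set y | exists2 x, X x & acc x y].
Proof.
move=> [Y BY ->]; have [Z [BZ h1 h2]] := image BY; exists Z => //.
apply/seteqP; split=> [y [x Yx xy]|y Zy]; first exact: h1 xy.
have [x Yx xy] := h2 _ (svalP y) Zy.
(* The predecessor [x] found so far may fail to be an atom; the admissible set of predecessors of
   [y] inside [Y] contains one that is. *)
have Bp := closed_pre closed (svalP y).
have [|z Bz [Yz [_ -> zy]]] := atomic (BI BY Bp) (x := x).
  by split=> //; exists (sval y).
by exists (exist _ z Bz).
Qed.

Definition atom_root : FA := exist _ w0 root_atom.

(** A path in [F] is retraced through atoms: [atomic_dia] is applied to the admissible set of worlds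
    from which [y] is [k] steps away. *)
Lemma atom_reach (y : FA) : exists k, racc k atom_root y.
Proof.
have [k [z [_ + zy]]] := reach (svalP y) (erefl : [set sval y] (sval y)).
rewrite (zy : z = sval y) => wy; exists k; move: wy; rewrite -[w0]/(sval atom_root).
elim: k atom_root => [|k IH] x /=; first exact: (@sval_inj F (fun x => B [set x])).
move=> [u xu uy].
have Bk : B (gsem B (fun=> [set sval y]) (DiaN k (Var 0))).
  by apply: closed => _; apply: (svalP y).
have [|t [Bz hz xz]] := atomic_dia (svalP x) Bk _ xu.
  by apply/gsem_DiaN; exists (sval y).
exists (exist _ t Bz) => //; apply: IH.
by move/gsem_DiaN: hz => [u' h e]; rewrite -(e : u' = sval y).
Qed.

End Atoms.

(** * The saturated frame *)

Section Saturated.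
Variables (L : set form) (HL : npqml L) (HBc : Bc `<=` L) (n : nat).
Hypothesis master : forall a, L (Imp (DiaN n.+1 a) (DiaLe n a)).
Variables (w : set form) (mw : mcs L w) (ww : witnessed w).

(** The last condition is a syntactic form of connection with [w]. It provides a path within [n]
    steps to every formula of [x] ([sat_reach]), though not to [x] itself. *)
Definition sat_world : Type :=
  {x : form -> Prop | [/\ mcs L x, witnessed x & forall a, x a -> w (DiaLe n a)]}.

Lemma root_DiaLe a : w a -> w (DiaLe n a).
Proof.
apply: (mcs_LImp mw); elim: (n) => [|k IH]; first exact: (L_refl HL a).
by rewrite DiaLeS; apply: L_taut1 IH _ => //; taut.
Qed.

Definition sat_root : sat_world := exist _ (w : form -> Prop) (And3 mw ww root_DiaLe).

Definition sat_frame : frame :=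
  @Frame sat_world (fun x y => canon_acc (sval x) (sval y)) (inhabits sat_root).

Local Notation FS := sat_frame.

Lemma sat_mcs (x : FS) : mcs L (sval x). Proof. by case: (svalP x). Qed.
Lemma sat_witnessed (x : FS) : witnessed (sval x). Proof. by case: (svalP x). Qed.

Lemma L_DiaLe_Dia a : L (Imp (DiaLe n (Dia a)) (DiaLe n a)).
Proof.
have h : L (Imp (DiaLe n (Dia a)) (DiaLe n.+1 a)).
  elim: (n) => [|k IH]; first by rewrite DiaLeS; apply: L_taut => //; taut.
  rewrite DiaLeS [DiaLe k.+2 a]DiaLeS.
  have -> : DiaN k.+1 (Dia a) = DiaN k.+2 a by rewrite /DiaN -iterSr.
  by apply: L_taut1 IH _ => //; taut.
by rewrite DiaLeS in h; apply: L_taut2 h (master a) _ => //; taut.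
Qed.

Lemma sat_dia (x : FS) a : sval x (Dia a) -> exists2 y : FS, sval y a & acc x y.
Proof.
move=> /(mcs_dia_witnessed HL HBc (sat_mcs x) (sat_witnessed (x:=x))).
move=> [y [my wy xy ya]].
have h b : y b -> w (DiaLe n b).
  move=> /xy yb; have [_ _ /(_ _ yb)] := svalP x.
  by apply: (mcs_LImp mw); apply: L_DiaLe_Dia.
by exists (exist _ y (And3 my wy h)).
Qed.

Definition form_set (a : form) : set FS := [set x | sval x a].

Definition form_sets : set (set FS) := range form_set.

(** At [Ex] one direction is the instance axiom and the other comes from witnesses; [subst_subst1]
    merges the instance with the outer substitution. *)
Lemma sat_truth s a (x : FS) :
  gsem form_sets (fun p => form_set (s p)) a x <-> sval x (subst s a).
Proof.
elim: a s x => [p|a IH|a IHa b IHb|a IH|p a IH] s x //.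
- by rewrite /= (mcs_neg (sat_mcs x)); apply: not_iff_compat; apply: IH.
- by rewrite gsem_Or IHa IHb; apply: iff_sym; exact: (mcs_or HL _ _ (sat_mcs x)).
- split=> [[y /IH hy xy]|/sat_dia[y /IH hy xy]]; last by exists y.
  exact: xy.
rewrite subst_Ex gsem_Ex; set q := exvar s p a.
have e c : sval x (subst (update Var q c) (subst (update s p (Var q)) a)) <->
           sval x (subst (update s p c) a).
  apply: mcs_eqv (sat_mcs x) _; apply: subst_subst1 => // r.
  exact: exvar_fresh.
split=> [[_ [c _ <-]]|/sat_witnessed[c /e hc]].
  rewrite -(upd_comp form_set) => /IH/e; apply: mcs_LImp (sat_mcs x) _.
  exact: npqml_inst.
exists (form_set c); first by exists c.
by rewrite -(upd_comp form_set); apply/IH.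
Qed.

Lemma form_sets_val (v : nat -> set FS) : (forall p, form_sets (v p)) ->
  exists s, v = fun p => form_set (s p).
Proof.
move=> h; have h' p : exists c, v p = form_set c by have [c _ <-] := h p; exists c.
by have [s hs] := choice h'; exists s; apply/funext.
Qed.

Lemma sat_closed v a : (forall p, form_sets (v p)) -> form_sets (gsem form_sets v a).
Proof.
move=> /form_sets_val[s ->]; exists (subst s a) => //.
by apply/seteqP; split=> x; rewrite sat_truth.
Qed.

Lemma sat_separated (x y : FS) :
  (forall X, form_sets X -> X x -> X y) -> x = y.
Proof.
move=> h; apply: sval_inj; apply: mcs_eq (sat_mcs x) (sat_mcs y) _ => a xa.
by apply: (h (form_set a)) => //; exists a.
Qed.

Lemma sat_valid_at v a x : (forall p, form_sets (v p)) -> L a -> gsem form_sets v a x.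
Proof.
move=> /form_sets_val[s ->] La; apply/sat_truth; apply: mcs_L (sat_mcs x) _ _.
exact: L_subst.
Qed.

Lemma sat_truth_id a (x : FS) :
  gsem form_sets (fun p => form_set (Var p)) a x <-> sval x a.
Proof. by rewrite sat_truth subst_id. Qed.

Lemma sat_reach X (x : FS) : form_sets X -> X x ->
  exists j y, [/\ j <= n, racc j (sat_root : FS) y & X y].
Proof.
move=> [a _ <-] xa; have [_ _ /(_ _ xa)] := svalP x.
rewrite -[w]/(sval (sat_root : FS)) -sat_truth_id.
by move=> /gsem_DiaLe[j [y [jn ry /sat_truth_id ya]]]; exists j, y.
Qed.

End Saturated.

(** * Counting up to a threshold *)

Section AtLeast.
Variable T : Type.
Implicit Types (C X Y : set T) (x y : T) (m k t : nat).

(** Counting by removal makes sense for infinite sets and fits the one-point changes below. *)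
Fixpoint atleast m C : Prop :=
  if m is m'.+1 then exists2 x, C x & atleast m' (C `\ x) else True.

Lemma atleast_sub m C C' : C `<=` C' -> atleast m C -> atleast m C'.
Proof.
elim: m C C' => [//|m IH] C C' CC' [x Cx h]; exists x; first exact: CC'.
by apply: IH h => y [/CC'].
Qed.

Lemma atleast_le k m C : k <= m -> atleast m C -> atleast k C.
Proof.
elim: m k C => [|m IH] [|k] C //= km [x Cx h]; exists x => //.
exact: IH km h.
Qed.

Lemma atleast_rem m C x : C x -> atleast m.+1 C -> atleast m (C `\ x).
Proof.
elim: m C => [//|m IH] C Cx [y Cy h].
case: (pselect (x = y)) => [->//|xy].
have := IH (C `\ y) (conj Cx xy) h; exists y; first by split=> // e; apply: xy.
by rewrite setDDl setUC -setDDl.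
Qed.

Lemma atleast_add i j C X : X `<=` C -> atleast i X -> atleast j (C `\` X) ->
  atleast (i + j) C.
Proof.
elim: i C X => [|i IH] C X XC; first by move=> _; apply: atleast_sub => y [].
move=> [x Xx h] hj; exists x; first exact: XC.
apply: (IH _ (X `\ x)) => //; first by move=> y [/XC Cy yx]; split.
by apply: atleast_sub hj => y [Cy nXy]; split=> [|[]//]; split=> // e; apply: nXy;
  rewrite e.
Qed.

Lemma atleast_diff j m C X : X `<=` C -> ~ atleast m.+1 X ->
  atleast (j + m) C -> atleast j (C `\` X).
Proof.
elim: m C X => [|m IH] C X XC nX h.
  rewrite addn0 in h; apply: atleast_sub h => y Cy; split=> // Xy.
  by apply: nX; exists y.
case: (pselect (exists x, X x)) => [[x Xx]|nx]; last first.
  have : atleast j C by apply: atleast_le h; rewrite leq_addr.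
  by apply: atleast_sub => y Cy; split=> // Xy; apply: nx; exists y.
have h' : atleast (j + m) (C `\ x) by apply: atleast_rem; rewrite -?addnS //; apply: XC.
have hX : X `\ x `<=` C `\ x by move=> y [/XC Cy yx]; split.
have nX' : ~ atleast m.+1 (X `\ x) by move=> h2; apply: nX; exists x.
have := IH _ _ hX nX' h'; apply: atleast_sub.
by move=> y [[Cy yx] h2]; split=> // Xy; apply: h2.
Qed.

Lemma atleast_exact i m C : atleast m C -> ~ atleast m.+1 C ->
  atleast i C <-> i <= m.
Proof.
move=> hm nm; split=> [hi|im]; last exact: atleast_le hm.
by rewrite leqNgt; apply/negP => mi; apply: nm; apply: atleast_le hi.
Qed.

Definition simn t C C' := forall m, m <= t -> atleast m C <-> atleast m C'.

Lemma simn_sym t C C' : simn t C C' -> simn t C' C.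
Proof. by move=> h m mt; apply: iff_sym; apply: h. Qed.

Lemma simn_le t t' C C' : t <= t' -> simn t' C C' -> simn t C C'.
Proof. by move=> tt h m mt; apply: h; apply: leq_trans tt. Qed.

Lemma simn_rem t C C' x x' : C x -> C' x' -> simn t.+1 C C' ->
  simn t (C `\ x) (C' `\ x').
Proof.
move=> Cx Cx' h m mt; split=> hm.
  by apply: atleast_rem => //; apply/h => //; exists x.
by apply: atleast_rem => //; apply/h => //; exists x'.
Qed.

Lemma simn_add t C C' x x' : C x -> C' x' -> simn t (C `\ x) (C' `\ x') ->
  simn t C C'.
Proof.
move=> Cx Cx' h [|m] mt //; have mt' : m <= t by apply: ltnW.
split=> hm.
  by exists x' => //; apply/(h _ mt')/atleast_rem.
by exists x => //; apply/(h _ mt')/atleast_rem.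
Qed.

Variable B : set (set T).
Hypothesis BC : forall X, B X -> B (~` X).
Hypothesis BU : forall X Y, B X -> B Y -> B (X `|` Y).
Hypothesis B1 : forall x, B [set x].

Let BI X Y : B X -> B Y -> B (X `&` Y).
Proof. by move=> BX BY; rewrite -[_ `&` _]setCK setCI; apply/BC/BU; apply: BC. Qed.

Let BD X Y : B X -> B Y -> B (X `\` Y).
Proof. by move=> BX BY; rewrite setDE; apply: BI => //; apply: BC. Qed.

(** A subset of exact size [m] is a finite union of singletons, hence admissible even if [C] is not;
    [D] serves to express the empty set. *)
Lemma atleast_pick m C D : B D -> atleast m C ->
  exists Y, [/\ B Y, Y `<=` C, atleast m Y & ~ atleast m.+1 Y].
Proof.
move=> BD0; elim: m C => [|m IH] C.
  move=> _; exists set0; split=> //=; last by move=> [].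
  by rewrite -(setICr D); apply: BI => //; apply: BC.
move=> [x Cx /IH[Y [BY YC h nh]]]; exists (x |` Y).
have e : (x |` Y) `\ x = Y.
  by apply/seteqP; split=> y => [[[->|]//] []|Yy]; split; [right|case: (YC y Yy)].
split; first exact: BU.
- by move=> y [->//|/YC[]].
- by exists x; [left|rewrite e].
- by move=> h2; apply: nh; rewrite -e; apply: atleast_rem => //; left.
Qed.

(** [P] has an exact size [m < t] and is answered by a set of the same size. The complements lose
    [m] elements on both sides, and counts [j + m] with [j <= t] stay within [t + t]. *)
Let split_small t C C' P : P `<=` C -> B C' -> simn (t + t) C C' -> ~ atleast t P ->
  exists Y, [/\ B Y, Y `<=` C', simn t P Y & simn t (C `\` P) (C' `\` Y)].
Proof.
move=> PC BC' CC' nP.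
have [m mt [hm nm]] : exists2 m, m < t & atleast m P /\ ~ atleast m.+1 P.
  elim: t nP {CC'} => [[]//|t IH nP]; case: (pselect (atleast t P)) => ht.
    by exists t.
  by have [m mt h] := IH ht; exists m => //; apply: ltnW.
have mtt j : j <= t -> j + m <= t + t by move=> jt; rewrite leq_add // ltnW.
have [Y [BY YC hY nY]] := atleast_pick (m :=
    m) BC' ((CC' m (mtt 0 (leq0n t))).1 (atleast_sub PC hm)).
exists Y; split=> // [j _|j jt]; first by rewrite !(@atleast_exact j m).
split=> h.
  apply: (atleast_diff (m := m)) => //; apply/CC'; first exact: mtt.
  by rewrite addnC; apply: atleast_add h.
apply: (atleast_diff (m := m)) => //; apply/CC'; first exact: mtt.
by rewrite addnC; apply: atleast_add h.
Qed.

(** A part of [C] with fewer than [t] elements is copied in exact size. If both parts have [t], then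
    [C], hence [C'], has [t + t], and any [t] of them may form one part: this is why the threshold
    doubles. *)
Lemma simn_split t C C' X : B C' -> simn (t + t) C C' ->
  exists Y, [/\ B Y, Y `<=` C', simn t (C `&` X) Y & simn t (C `\` X) (C' `\` Y)].
Proof.
move=> BC' CC'.
have eD : C `\` (C `&` X) = C `\` X.
  by apply/seteqP; split=> y [Cy h]; split=> // h'; apply: h => //; case: h'.
have eI : C `\` (C `\` X) = C `&` X.
  apply/seteqP; split=> y [Cy h]; split=> //; last by case.
  by apply: contrapT => h'; apply: h.
case: (pselect (atleast t (C `&` X))) => hX; last first.
  by have := split_small (@subIsetl _ C X) BC' CC' hX; rewrite eD.
case: (pselect (atleast t (C `\` X))) => hN; last first.
  have [Y [BY YC h1 h2]] := split_small (@subDsetl _ C X) BC' CC' hN.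
  exists (C' `\` Y); split=> //; [exact: BD|by rewrite -eI|].
  by rewrite setDD setIC (setIidl YC).
have /CC' hC : atleast (t + t) C.
  by apply: (@atleast_add _ _ _ (C `&` X)) => //; rewrite eD.
have {}hC := hC (leqnn _).
have [Y [BY YC hY nY]] := atleast_pick BC' (atleast_le (leq_addr t t) hC).
exists Y; split=> // j jt; split=> _.
- exact: atleast_le hY.
- exact: atleast_le hX.
- by apply: (atleast_le jt); apply: (atleast_diff (m := t)).
- exact: atleast_le hN.
Qed.

(** The marked points are taken out, the rest is split, and they are put back on matching sides;
    taking them out costs the extra one. *)
Lemma simn_split_point t C C' X x x' : C x -> C' x' -> B C' ->
  simn (t + t).+1 C C' ->
  exists Y, [/\ B Y, Y `<=` C', X x <-> Y x',
    simn t (C `&` X) Y & simn t (C `\` X) (C' `\` Y)].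
Proof.
move=> Cx Cx' BC' /(simn_rem Cx Cx')/(@simn_split _ _ _ X).
move=> /(_ (BD BC' (B1 x')))[Y [BY YC h1 h2]].
have nYx : ~ Y x' by move=> /YC[_]; apply.
case: (pselect (X x)) => Xx.
  exists (x' |` Y); split.
  - exact: BU.
  - by move=> y [->//|/YC[]].
  - by split=> // _; left.
  - apply: (@simn_add _ _ _ x x') => //; first by left.
    rewrite (_ : (C `&` X) `\ x = (C `\ x) `&` X); last first.
      by apply/seteqP; split=> y [[]].
    rewrite (_ : (x' |` Y) `\ x' = Y) //.
    apply/seteqP; split=> y => [[[->|]//] []|Yy]; split; first by right.
    by move=> e; apply: nYx; rewrite -e.
  - rewrite (_ : C `\` X = (C `\ x) `\` X); last first.
      apply/seteqP; split=> y => [[Cy nX]|[[]]]; split=> //; split=> // e.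
      by apply: nX; rewrite e.
    by rewrite -setDDl in h2 *.
exists Y; split=> //; first by move=> y /YC[].
  rewrite (_ : C `&` X = (C `\ x) `&` X) //.
  apply/seteqP; split=> y => [[Cy Xy]|[[]]]; split=> //; split=> // e.
  by apply: Xx; rewrite -e.
apply: (@simn_add _ _ _ x x') => //.
by rewrite !setDDl ![_ `|` [set _]]setUC -!setDDl.
Qed.

End AtLeast.

(** * Elementary equivalence of general and full semantics *)

Section Colours.
Variable T : Type.
Implicit Types (c : T -> nat) (X : set T).

Definition fiber c (k : nat) : set T := [set z | c z = k].

(** The last bit of the new colour records membership in [X]; halving recovers the old colour. *)
Definition refine c X : T -> nat := fun z => (c z).*2 + `[< X z >].

Lemma odd_refine c X z : odd (refine c X z) = `[< X z >].
Proof. by rewrite /refine oddD odd_double /= oddb. Qed.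

Lemma half_refine c X z : (refine c X z)./2 = c z.
Proof. by rewrite /refine addnC half_bit_double. Qed.

Lemma fiber_refine c X k :
  fiber (refine c X) k = if odd k then fiber c k./2 `&` X else fiber c k./2 `\` X.
Proof.
have kE := odd_double_half k.
apply/seteqP; split=> z; rewrite /fiber.
  move=> /= <-; rewrite odd_refine half_refine.
  by case: asboolP => h; split.
rewrite /refine -[k in X in _ -> X]kE; case: (odd k) => /= -[-> h].
  by rewrite asboolT // addnC.
by rewrite asboolF // addn0.
Qed.

Variable B : set (set T).
Hypothesis BC : forall X, B X -> B (~` X).
Hypothesis BU : forall X Y, B X -> B Y -> B (X `|` Y).
Hypothesis BT : B setT.

Let BI X Y : B X -> B Y -> B (X `&` Y).
Proof. by move=> BX BY; rewrite -[_ `&` _]setCK setCI; apply/BC/BU; apply: BC. Qed.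

Lemma refine_closed c X k : (forall k, B (fiber c k)) -> B X ->
  B (fiber (refine c X) k).
Proof.
move=> Bc BX; rewrite fiber_refine; case: ifP => _; first exact: BI.
by rewrite setDE; apply: BI => //; apply: BC.
Qed.

Lemma refine_bound c X N z : c z < N -> refine c X z < N.*2.
Proof.
move=> cz; apply: (@leq_trans (c z).+1.*2); last by rewrite leq_double.
by rewrite doubleS ltnS /refine -addn1 leq_add2l; case: asboolP.
Qed.

Lemma colouring (l : seq (set T)) : (forall X, List.In X l -> B X) ->
  exists N c, [/\ forall z, c z < N, forall k, B (fiber c k) &
    forall X, List.In X l -> forall z z', c z = c z' -> X z <-> X z'].
Proof.
elim: l => [|X l IH] Bl.
  exists 1, (fun=> 0); split=> // k; rewrite /fiber; case: k => [|k].
    by have := BT; congr B; apply/seteqP.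
  by have := BC BT; congr B; apply/seteqP; split=> z; first by move=> /(_ I).
have [|N [c [cN Bc cl]]] := IH; first by move=> Y lY; apply: Bl; right.
have BX : B X by apply: Bl; left.
exists N.*2, (refine c X); split.
- by move=> z; apply: refine_bound.
- by move=> k; apply: refine_closed.
move=> Y [<-|lY] z z' e; last by apply: cl => //;
  rewrite -(half_refine c X) e half_refine.
have := odd_refine c X z; rewrite e odd_refine => e'.
by split=> h; apply/asboolP; [rewrite e'|rewrite -e']; apply/asboolP.
Qed.

Lemma finite_union N c (Y : nat -> set T) : (forall z, c z < N) ->
  (forall k, B (Y k)) -> (forall k, Y k `<=` fiber c k) ->
  B [set z | Y (c z) z].
Proof.
move=> cN BY Yc.
have h M : B [set z | c z < M /\ Y (c z) z].
  elim: M => [|M IH].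
    by have := BC BT; congr B; apply/seteqP; split=> [z /(_ I)|z []].
  have := BU IH (BY M); congr B.
  apply/seteqP; split=> [z [[zM Yz]|Yz]|z [+ Yz]].
  - by split=> //; apply: ltnW.
  - by have e : c z = M := Yc _ _ Yz; rewrite /= e.
  - rewrite ltnS leq_eqVlt => /orP[/eqP e|zM]; last by left.
    by right; rewrite -e.
by have := h N; congr B; apply/seteqP; split=> z => [[]|].
Qed.

End Colours.

(** * A back-and-forth game between two colourings of one frame *)

Section Matching.
Variable F : frame.
Implicit Types (c : F -> nat) (x y z : F).

(** A position of the game: the colourings code the sets chosen so far, [x] and [x'] are the current
    worlds, and [t] is the precision left for class sizes. By the last field, colours and equality
    decide accessibility. *)
Record matched (t N : nat) c c' x x' : Prop := Matched {
  matched_boundl : forall z, c z < N;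
  matched_boundr : forall z, c' z < N;
  matched_size : forall k, simn t (fiber c k) (fiber c' k);
  matched_point : c x = c' x';
  matched_acc : forall z u z' u', c z = c' z' -> c u = c' u' ->
    (z = u <-> z' = u') -> acc z u <-> acc z' u' }.

Lemma matched_sym t N c c' x x' : matched t N c c' x x' -> matched t N c' c x' x.
Proof.
move=> [h1 h2 h3 h4 h5]; split=> //; first by move=> k; apply: simn_sym.
move=> z u z' u' e1 e2 e3; apply: iff_sym; apply: h5 => //.
exact: iff_sym.
Qed.

(** If [y] has the colour of [x] but differs from it, [y'] must be a second world of that colour:
    hence the precision 2. *)
Lemma matched_move t N c c' x x' y : matched t N c c' x x' -> 2 <= t -> acc x y ->
  exists2 y', matched t N c c' y y' & acc x' y'.
Proof.
move=> [h1 h2 h3 h4 h5] t2 xy.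
suff [y' [e1 e2]] : exists y', c y = c' y' /\ (x = y <-> x' = y').
  by exists y'; [split|apply/(h5 x y)].
case: (pselect (x = y)) => [<-|nxy]; first by exists x'.
case: (pselect (c y = c x)) => [cyx|ncyx].
  have : atleast 2 (fiber c (c x)).
    by exists x => //; exists y => //; split=> // e; apply: nxy; rewrite e.
  move=> /(h3 _ _ t2) /(atleast_rem (esym h4 : fiber c' (c x) x'))[y' [e ne] _].
  by exists y'; split; [rewrite cyx -e|split=> // ee; case: ne].
have : atleast 1 (fiber c (c y)) by exists y.
move=> /(h3 _ _ (ltnW t2))[y' e _]; exists y'; split=> //.
by split=> // ee; case: ncyx; rewrite h4 ee e.
Qed.

Section Step.
Variable B : set (set F).
Hypothesis BC : forall X, B X -> B (~` X).
Hypothesis BU : forall X Y, B X -> B Y -> B (X `|` Y).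
Hypothesis BT : B setT.
Hypothesis B1 : forall x, B [set x].

(** [X] is answered in each colour class separately; the class of the current world uses the pointed
    splitting, so that [x] and [x'] stay alike. *)
Lemma matched_step t N c c' x x' X :
  matched (t + t).+1 N c c' x x' -> (forall k, B (fiber c' k)) ->
  exists2 Y, B Y & matched t N.*2 (refine c X) (refine c' Y) x x'.
Proof.
move=> [h1 h2 h3 h4 h5] Bc'.
have split_k k : exists Y, [/\ B Y, Y `<=` fiber c' k, k = c x -> (X x <-> Y x'),
    simn t (fiber c k `&` X) Y & simn t (fiber c k `\` X) (fiber c' k `\` Y)].
  case: (pselect (k = c x)) => [->|nk].
    have xc : fiber c (c x) x by [].
    have xc' : fiber c' (c x) x' by apply: esym.
    by have [Y [BY YC e s1 s2]] :=
        simn_split_point BC BU B1 X xc xc' (Bc' _) (h3 (c x)); exists Y.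
  have h3k : simn (t + t) (fiber c k) (fiber c' k) by apply: simn_le (h3 k).
  have [Y [BY YC s1 s2]] := simn_split BC BU B1 X (Bc' k) h3k.
  by exists Y; split=> // /nk.
have [Y hY] := choice split_k.
have Yc k : Y k `<=` fiber c' k by have [] := hY k.
exists [set z | Y (c' z) z].
  by apply: (finite_union BC BU BT h2) => // k; have [] := hY k.
have eI k : fiber c' k `&` [set z | Y (c' z) z] = Y k.
  apply/seteqP; split=> z; first by move=> [<-].
  by move=> Yz; have e := Yc _ _ Yz; split; rewrite //= e.
have eD k : fiber c' k `\` [set z | Y (c' z) z] = fiber c' k `\` Y k.
  apply/seteqP; split=> z [e nY]; split=> //; last by rewrite /= e.
  by move: nY; rewrite /= e.
split.
- by move=> z; apply: refine_bound.
- by move=> z; apply: refine_bound.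
- move=> k; rewrite !fiber_refine; case: ifP => _.
    by rewrite eI; have [] := hY k./2.
  by rewrite eD; have [] := hY k./2.
- have [_ _ /(_ erefl) e _ _] := hY (c x).
  by rewrite /refine h4 /= -h4; congr (_ + nat_of_bool _); apply/asbool_equiv_eq.
move=> z u z' u' e1 e2; apply: h5.
  by rewrite -(half_refine c X z) e1 half_refine.
by rewrite -(half_refine c X u) e2 half_refine.
Qed.

End Step.

(** The base 2 is what [matched_move] requires, the clause for [Ex] what [matched_step] consumes. *)
Fixpoint threshold (a : form) : nat :=
  match a with
  | Var _ => 2
  | Neg b | Dia b => threshold b
  | Or b c => maxn (threshold b) (threshold c)
  | Ex _ b => (threshold b + threshold b).+1
  end.

Lemma threshold_ge2 a : 2 <= threshold a.
Proof.
elim: a => //= [a IHa b IHb|p a IH]; first by rewrite leq_max IHa.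
by apply: leq_trans IH _; rewrite -addnS leq_addr.
Qed.

Lemma matched_le t t' N c c' x x' : t <= t' -> matched t' N c c' x x' ->
  matched t N c c' x x'.
Proof. by move=> tt [h1 h2 h3 h4 h5]; split=> // k; apply: simn_le (h3 k). Qed.

Variable B : set (set F).
Hypothesis BC : forall X, B X -> B (~` X).
Hypothesis BU : forall X Y, B X -> B Y -> B (X `|` Y).
Hypothesis BT : B setT.
Hypothesis B1 : forall x, B [set x].

(* [V] records which colours make up the value of each variable. *)
Lemma matched_gsem a N c c' x x' (v v' : nat -> set F) (V : nat -> nat -> Prop) :
  matched (threshold a) N c c' x x' -> (forall k, B (fiber c' k)) ->
  (forall p, p \in Fv a -> forall z, v p z <-> V p (c z)) ->
  (forall p, p \in Fv a -> forall z, v' p z <-> V p (c' z)) ->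
  gsem setT v a x <-> gsem B v' a x'.
Proof.
elim: a N c c' x x' v v' V => [p|a IH|a IHa b IHb|a IH|p a IH] N c c' x x' v v' V M Bc' hv hv'.
- by rewrite /= hv ?hv' ?inE // (matched_point M).
- by apply: not_iff_compat; apply: (IH _ _ _ _ _ _ _ V M Bc').
- rewrite !gsem_Or (IHa N c c' x x' v v' V) ?(IHb N c c' x x' v v' V) //.
  + by apply: matched_le M; rewrite /= leq_maxr.
  + by move=> p pb; apply: hv; rewrite mem_cat pb orbT.
  + by move=> p pb; apply: hv'; rewrite mem_cat pb orbT.
  + by apply: matched_le M; rewrite /= leq_maxl.
  + by move=> p pb; apply: hv; rewrite mem_cat pb.
  + by move=> p pb; apply: hv'; rewrite mem_cat pb.
- split=> -[y hy xy].
    have [y' My xy'] := matched_move M (threshold_ge2 (Dia a)) xy.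
    by exists y' => //; apply: (IH _ _ _ _ _ _ _ V My Bc' hv hv').1 hy.
  have [y' My xy'] := matched_move (matched_sym M) (threshold_ge2 (Dia a)) xy.
  by exists y' => //; apply: (IH _ _ _ _ _ _ _ V (matched_sym My) Bc' hv hv').2 hy.
(* For [p] the odd refined colours are those inside the chosen set; the other variables look at the
   halved colour. *)
pose V' := update (fun q k => V q k./2) p (fun k => odd k).
have colour (u : nat -> set F) d X :
    (forall q, q \in Fv (Ex p a) -> forall z, u q z <-> V q (d z)) ->
    forall q, q \in Fv a -> forall z, update u p X q z <-> V' q (refine d X z).
  move=> hu q qa z; rewrite /V' /update; case: eqP => [_|/eqP qp].
    by rewrite odd_refine; split=> /asboolP.
  by rewrite half_refine hu // mem_Fv_Ex qp.
rewrite !gsem_Ex; split=> -[X BX hX].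
  have [Y BY MY] := matched_step BC BU BT B1 X M Bc'.
  have BY' k : B (fiber (refine c' Y) k) by apply: refine_closed.
  by exists Y => //; apply: (IH _ _ _ _ _ _ _ V' MY BY' (colour _ _ _ hv) (colour _ _ _ hv')).1 hX.
(* Here the given set is admissible and the answer may be arbitrary, so [matched_step] is used with
   all sets as its family. *)
have CT X1 : setT X1 -> setT (~` X1 : set F) by [].
have UT (X1 Y1 : set F) : setT X1 -> setT Y1 -> setT (X1 `|` Y1) by [].
have [Y _ /matched_sym MY] := matched_step CT UT I (fun=> I) X (matched_sym M) (fun=> I).
have BX' k : B (fiber (refine c' X) k) by apply: refine_closed.
by exists Y => //; apply: (IH _ _ _ _ _ _ _ V' MY BX' (colour _ _ _ hv) (colour _ _ _ hv')).2 hX.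
Qed.

End Matching.

(** * An admissible finite colouring from finitely many duplicate classes *)

Section FullSemantics.
Variables (F : frame) (B : set (set F)) (v0 : nat -> set F).
Hypothesis closed : forall v a, (forall p, B (v p)) -> B (gsem B v a).
Hypothesis Bv0 : forall p, B (v0 p).
Hypothesis B1 : forall x, B [set x].
Hypothesis Bimage : forall X, B X -> B [set y | exists2 x, X x & acc x y].
Variable rs : seq F.
Hypothesis reps : forall z : F, exists2 r, List.In r rs & duplicates z r.

Let Bsucc (r : F) : B [set y | acc r y].
Proof.
have := Bimage (B1 r); congr B; apply/seteqP; split=> [y [_ -> //]|y ry].
by exists r.
Qed.

Let Bpred (r : F) : B [set y | acc y r].
Proof.
have := closed_pre closed (B1 r); congr B; apply/seteqP; split=> [y [_ -> //]|y ry].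
by exists r.
Qed.

(** Reflexivity of [y] is defined by [Box p -> p] for all [p]; admissible values suffice, since the
    successors of [y] form one. *)
Let Brefl : B [set y : F | acc y y].
Proof.
have := closed (All 0 (Imp (Box (Var 0)) (Var 0))) Bv0.
congr B; apply/seteqP; split=> y.
  move=> /gsem_All/(_ _ (Bsucc y))/gsem_Imp; apply; exact/gsem_Box.
by move=> yy; apply/gsem_All => X BX; apply/gsem_Imp => /gsem_Box; apply.
Qed.

(* The sets by which a finite colouring has to be refined so that the
   accessibility between distinct worlds depends on the colours only. *)
Definition basic_sets : seq (set F) :=
  [set y : F | acc y y] ::
  List.flat_map (fun r : F => [:: [set r]; [set y | acc r y]; [set y | acc y r]]) rs.

Let B_basic X : List.In X basic_sets -> B X.
Proof.
move=> [<-|/List.in_flat_map[r [_ [<-|[<-|[<-|[]]]]]]].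
- exact: Brefl.
- exact: B1.
- exact: Bsucc.
- exact: Bpred.
Qed.

Lemma basic_acc (c : F -> nat) :
  (forall X, List.In X basic_sets -> forall z z', c z = c z' -> X z <-> X z') ->
  forall z u z' u', c z = c z' -> c u = c u' -> (z = u <-> z' = u') ->
  acc z u <-> acc z' u'.
Proof.
move=> cb.
have refl z z' : c z = c z' -> acc z z <-> acc z' z'.
  by apply: (cb [set y | acc y y]); left.
have basic r X : List.In r rs ->
    List.In X [:: [set r]; [set y | acc r y]; [set y | acc y r]] ->
    forall z z', c z = c z' -> X z <-> X z'.
  by move=> hr hX; apply: cb; right; apply/List.in_flat_map; exists r.
have eqr r z z' : List.In r rs -> c z = c z' -> z = r <-> z' = r.
  by move=> hr; apply: (basic r [set r]) => //; left.
have succ r z z' : List.In r rs -> c z = c z' -> acc r z <-> acc r z'.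
  by move=> hr; apply: (basic r [set y | acc r y]) => //; right; left.
have pred r z z' : List.In r rs -> c z = c z' -> acc z r <-> acc z' r.
  by move=> hr; apply: (basic r [set y | acc y r]) => //; right; right; left.
move=> z u z' u' ez eu e.
case: (pselect (z = u)) => [zu|zu].
  by move/e: (zu) => zu'; rewrite -zu -zu'; apply: refl.
have zu' : z' <> u' by move=> /e.
(* [u] and [z'] are exchanged with representatives, whose successors and predecessors the colours
   record. An exchange requires distinct worlds; a world that equals the representative is
   identified by its colour instead. *)
have [r rr ur] := reps u; have [s ss zs] := reps z'.
case: (pselect (u = r)) => [E|nur].
  by rewrite ((eqr r _ _ rr eu).1 E) E; apply: pred.
case: (pselect (z' = s)) => [E|nzs].
  by rewrite ((eqr s _ _ ss ez).2 E) E; apply: succ.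
case: (pselect (z = r)) => [E|nzr].
  by rewrite ((eqr r _ _ rr ez).1 E) E; apply: succ.
case: (pselect (u' = s)) => [E|nus].
  by rewrite ((eqr s _ _ ss eu).2 E) E; apply: pred.
have nzr' : z' <> r by move/(eqr r _ _ rr ez).
have nus' : u <> s by move/(eqr s _ _ ss eu).
rewrite (duplicates_accR ur zu nzr) (pred r _ _ rr ez).
rewrite (duplicates_accL zs (nesym zu') nus) -(succ s _ _ ss eu).
(* It remains to compare [acc z' r] with [acc s u]. If [r = s], then [u] and [z'] are both
   duplicates of [r]. *)
case: (pselect (r = s)) => [rs_|nrs]; last first.
  rewrite (duplicates_accL zs (nesym nzr') nrs).
  by rewrite (duplicates_accR ur (nesym nus') (nesym nrs)).
rewrite -rs_ in zs nus' *.
case: (pselect (z' = u)) => [E|nzu].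
  by rewrite E in zs *; apply: duplicates_accC.
by rewrite -(duplicates_accR ur nzu nzr') (duplicates_accL zs (nesym nzu) nus').
Qed.

(** The game starts with the same colouring and the same world on both sides; afterwards one side
    chooses arbitrary sets and the other admissible ones. *)
Lemma full_semantics v a x : (forall p, B (v p)) -> sem v a x <-> gsem B v a x.
Proof.
move=> Bv; rewrite -gsemT.
pose l := basic_sets ++ List.map v (Fv a).
have lE X : List.In X l <-> List.In X basic_sets \/ List.In X (List.map v (Fv a)).
  exact: (@List.in_app_iff (set F) basic_sets (List.map v (Fv a)) X).
have [|N [c [cN Bc cl]]] := colouring (closedC closed) (closedU closed)
    (closedT closed (Bv0 0)) (l := l).
  by move=> X /lE[h|/List.in_map_iff[p [<- _]]]; [apply: B_basic|apply: Bv].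
have vc p : p \in Fv a -> forall z, v p z <-> exists2 z', c z' = c z & v p z'.
  move=> pa z; split=> [vz|[z' e]]; first by exists z.
  apply: (cl (v p) _ z' z e).1; apply/lE; right; apply: List.in_map.
  by elim: (Fv a) pa => //= q l' IH; rewrite inE => /orP[/eqP->|/IH]; [left|right].
apply: (@matched_gsem F B (closedC closed) (closedU closed)
  (closedT closed (Bv0 0)) B1 a N c c x x v v
  (fun p k => exists2 z, c z = k & v p z)) => //.
by split=> //; apply: basic_acc => X hX; apply: cl; apply/lE; left.
Qed.

End FullSemantics.

(** * Strong completeness *)

Lemma swapK (T : Type) (x y : T) : involutive (swap x y).
Proof.
move=> z; case: (pselect (z = x)) => [->|zx]; first by rewrite swapL swapR.
case: (pselect (z = y)) => [->|zy]; first by rewrite swapR swapL.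
by rewrite (@swapD _ _ _ z) // swapD.
Qed.

Lemma sval_swap (F : frame) (w : F) (x y z : generated_subframe w) :
  sval (swap x y z) = swap (sval x) (sval y) (sval z).
Proof.
case: (pselect (z = x)) => [->|zx]; first by rewrite !swapL.
case: (pselect (z = y)) => [->|zy]; first by rewrite !swapR.
by rewrite !swapD // => /sval_inj.
Qed.

Lemma duplicates_generated (F : frame) (w : F) (x y : generated_subframe w) :
  (forall z : F, clos_refl_trans F (@acc F) w z) ->
  duplicates x y -> duplicates (sval x) (sval y).
Proof.
move=> all_w [_ h]; split; first exact: inv_bij (swapK _ _).
move=> a b; pose a' : generated_subframe w := exist _ a (all_w a).
pose b' : generated_subframe w := exist _ b (all_w b).
by have := h a' b'; rewrite -[a]/(sval a') -[b]/(sval b') -!sval_swap.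
Qed.

Lemma colour_reps (T : Type) (c : T -> nat) n : (forall z, c z < n) ->
  exists rs : seq T, forall z, exists2 r, List.In r rs & c z = c r.
Proof.
move=> cn; suff [rs h] : exists rs : seq T, forall z, c z < n ->
    exists2 r, List.In r rs & c z = c r by exists rs => z; apply: h.
elim: n {cn} => [|n [rs h]]; first by exists [::].
case: (pselect (exists z, c z = n)) => [[z zn]|nz]; last first.
  exists rs => y; rewrite ltnS leq_eqVlt => /orP[/eqP yn|/h//].
  by case: nz; exists y.
exists (z :: rs) => y; rewrite ltnS leq_eqVlt => /orP[/eqP yn|/h[r hr e]].
  by exists z; [left|rewrite yn].
by exists r => //; right.
Qed.

Lemma diversity_reps (F : frame) (w : F) n :
  (duplicate_classes (generated_subframe w) #<= `I_n)%card ->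
  (forall z : F, clos_refl_trans F (@acc F) w z) ->
  exists rs : seq F, forall z, exists2 r, List.In r rs & duplicates z r.
Proof.
move=> /duplicate_color[c cn cdup] all_w.
pose e z : generated_subframe w := exist _ z (all_w z).
have [rs h] := @colour_reps _ (fun z => c (e z)) n (fun z => cn (e z)).
exists rs => z; have [r hr zr] := h z; exists r => //.
exact: (@duplicates_generated _ _ (e z) (e r) all_w (cdup _ _ zr)).
Qed.

Lemma subst_DiaN s k a : subst s (DiaN k a) = DiaN k (subst s a).
Proof. by elim: k => //= k ->. Qed.

Lemma subst_DiaLe s k a : subst s (DiaLe k a) = DiaLe k (subst s a).
Proof. by elim: k => //= k ->; rewrite -/(DiaN k a) subst_DiaN. Qed.

Lemma quantifier_free_DiaN k a : quantifier_free a -> quantifier_free (DiaN k a).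
Proof. by elim: k. Qed.

Lemma quantifier_free_DiaLe k a : quantifier_free a -> quantifier_free (DiaLe k a).
Proof.
by move=> qa; elim: k => //= k IH; split=> //; apply: quantifier_free_DiaN.
Qed.

Section Consistency.
Variables (L : set form) (HL : npqml L).

Lemma L_bigAnd_catl s t : L (Imp (bigAnd (s ++ t)) (bigAnd s)).
Proof.
elim: s => [|a s IH] /=; first by apply: L_taut => //; taut.
by apply: L_taut1 IH _ => //; taut.
Qed.

Lemma L_bigAnd_catr s t : L (Imp (bigAnd (s ++ t)) (bigAnd t)).
Proof.
elim: s => [|a s IH] /=; first exact: L_refl.
by apply: L_taut1 IH _ => //; taut.
Qed.

Lemma Fv_bigAnd s x : x \in Fv (bigAnd s) ->
  x = 0 \/ exists2 a, List.In a s & x \in Fv a.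
Proof.
elim: s => [|a s IH] /=; first by rewrite !inE orbb => /eqP; left.
rewrite mem_cat => /orP[xa|/IH[->|[b sb xb]]]; [right|by left|right].
  by exists a => //; left.
by exists b => //; right.
Qed.

Lemma subst_bigAnd s l : s 0 = Var 0 ->
  subst s (bigAnd l) = bigAnd [seq subst s a | a <- l].
Proof. by move=> s0; elim: l => [|a l /= ->] //=; rewrite s0. Qed.

Let even : nat -> form := fun p => Var p.*2.
Let half : nat -> form := fun p => Var p./2.

Lemma L_bigAnd_half s :
  L (Imp (bigAnd s) (bigAnd [seq subst half a | a <- [seq subst even a | a <- s]])).
Proof.
elim: s => [|a s IH] /=; first exact: L_refl.
have [_ h] := subst_comp HL even half a.
rewrite (@subst_id (fun r => _)) in h; last by move=> r _ /=; rewrite /half doubleK.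
by apply: L_taut2 IH h _ => //; taut.
Qed.

(* The variables are renamed to even ones, so that the odd ones can serve as
   witnesses. *)
Lemma consistent_witnessed (Gamma : set form) : consistent L Gamma ->
  exists w, [/\ mcs L w, witnessed w & forall a, Gamma a -> w (subst even a)].
Proof.
move=> cG.
pose S s := bigAnd [seq subst even a | a <- s].
pose C b := forall s : seq form, (forall a, List.In a s -> Gamma a) -> ~ L (Neg (And b (S s))).
have Sl s t : L (Imp (S (s ++ t)) (S s)) by rewrite /S map_cat; apply: L_bigAnd_catl.
have Sr s t : L (Imp (S (s ++ t)) (S t)) by rewrite /S map_cat; apply: L_bigAnd_catr.
have SE s x : x \in Fv (S s) -> ~~ odd x.
  move=> /Fv_bigAnd[->//|[_ /List.in_map_iff[a [<- _]]]].
  by rewrite mem_Fv_subst => /hasP[r _]; rewrite inE => /eqP ->; rewrite odd_double.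
have [] := @lindenbaum L HL True C (Top 0).
- by move=> a b ab Ca s sG h; apply: (Ca s sG); apply: L_taut2 ab h _ => //; taut.
- move=> a Ca na; apply: (Ca [::]) => //; apply: L_taut1 na _ => //; taut.
- move=> a b Ca; apply: contrapT => /not_orP[/existsNP[s /not_implyP[sG /contrapT hs]]].
  move=> /existsNP[t /not_implyP[tG /contrapT ht]]; apply: (Ca (s ++ t)).
    by move=> c /List.in_app_iff[/sG|/tG].
  have h1 : L (Imp (S (s ++ t)) (Neg (And a b))).
    by apply: L_taut2 (Sl s t) hs _ => //; taut.
  have h2 : L (Imp (S (s ++ t)) (Neg (And a (Neg b)))).
    by apply: L_taut2 (Sr s t) ht _ => //; taut.
  by apply: L_taut2 h1 h2 _ => //; taut.
- move=> _ a p b Cab; pose l := Fv a ++ Fv (Ex p b).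
  (* Being odd, [q] is foreign to the renamed [Gamma]; being above the maximum, it is fresh for [a]
     and [Ex p b]. *)
  pose q := (\max_(p <- l) p).*2.+1.
  have : q \notin l.
    apply/negP => ql; have := @leq_bigmax_seq _ l xpredT id q ql isT.
    by rewrite /q -addnn leqNgt ltnS leq_addl.
  rewrite mem_cat negb_or => /andP[qa qb].
  exists (Var q) => s sG h; apply: (Cab s sG).
  set b' := subst _ b in h.
  have h1 : L (Imp (Ex q b') (Neg (And a (S s)))).
    apply: npqml_exE => //; first by apply: L_taut1 h _ => //; taut.
    rewrite /= mem_cat negb_or qa; apply/negP => /SE.
    by rewrite /q /= odd_double.
  have h2 := L_Ex_rename HL qb.
  by apply: L_taut2 h1 h2 _ => //; taut.
- move=> s sG h; apply: cG; exists s => //.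
  have h1 : L (Neg (S s)) by apply: L_taut1 h _ => //; taut.
  (* Halving undoes the renaming, so an inconsistency of the renamed formulas is one of [Gamma]. *)
  have := L_subst HL half h1; rewrite /= subst_bigAnd // => h2.
  by apply: L_taut2 h2 (L_bigAnd_half s) _ => //; taut.
move=> w [mw _ wC ww]; exists w; split=> //; first exact: ww.
move=> a Ga; apply: contrapT => /(mcs_neg mw)/wC/(_ [:: a]); apply.
  by move=> b [<-|[]].
by apply: L_taut => //; taut.
Qed.

End Consistency.

Lemma KPi_axiom (A : set form) : A `<=` KPi A.
Proof. by move=> a Aa M [_]; apply. Qed.

Lemma L_master (L : set form) (HL : npqml L) (Theta : set form) (n : nat) a :
  Theta `<=` L -> Theta `<=` quantifier_free -> Theta `<=` sahlqvist ->
  class_diversity (KFr Theta) n -> L (Imp (DiaN n.+1 a) (DiaLe n a)).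
Proof.
move=> TL Tqf Ts [div _]; apply: L_complete => // x mx.
pose i : inhabited (mcs_type L) := inhabits (exist _ (x : form -> Prop) mx).
have KF : KFr Theta (canonical_frame i).
  by move=> b Tb; apply: canonical_sahlqvist => //; [apply: Ts|apply: Tqf|apply: TL].
pose y : canonical_frame i := exist _ (x : form -> Prop) mx.
apply/(mcs_or HL _ _ mx); case: (pselect (x (DiaN n.+1 a))) => [h|/(mcs_neg mx)];
  [right|by left].
(* [a] may contain quantifiers, which [canonical_truth] does not cover; it is treated as the value
   of a variable in a quantifier-free formula. *)
have truth b : quantifier_free b -> gsem setT (ext_val (i :=
    i) (fun=> a)) b y <-> x (subst (fun=> a) b).
  exact: canonical_truth.
have := truth (DiaN n.+1 (Var 0)) (@quantifier_free_DiaN _ (Var 0) I).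
rewrite subst_DiaN => -[_ /(_ h)/gsem_DiaN[z yz za]].
have [j jn yjz] := diversity_bounded (div _ _ KF) yz.
have := truth (DiaLe n (Var 0)) (@quantifier_free_DiaLe _ (Var 0) I).
by rewrite subst_DiaLe => <-; apply/gsem_DiaLe; exists j, z.
Qed.

(** A minimal valuation is a finite union of iterated images of singletons; this is where closure
    under images pays off. *)
Lemma min_val_closed (F : frame) (B : set (set F)) l p :
  (forall v a, (forall p, B (v p)) -> B (gsem B v a)) ->
  (forall x, B [set x]) ->
  (forall X, B X -> B [set y | exists2 x, X x & acc x y]) -> B (min_val l p).
Proof.
move=> closed B1 Bimage.
have Bracc k x : B [set y | racc k x y].
  elim: k => [|k IH]; first by have := B1 x; congr B; apply/seteqP; split=> y /=.
  have := Bimage _ IH; congr B; apply/seteqP; split=> y.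
    by move=> [z xz zy]; apply: raccS zy.
  by move=> /raccSr[z xz zy]; exists z.
elim: l => [|[[q k] x] l IH].
  have [x] := world_inhabited F; have := closedC closed (closedT closed (B1 x)).
  by congr B; apply/seteqP; split=> y [] // ? [? []].
case: (pselect (q = p)) => qp.
  have := closedU closed (Bracc k x) IH; congr B; apply/seteqP; split=> y.
    by move=> [xy|[j [z [jz zy]]]]; [exists k, x; split=> //; left;
      rewrite qp|exists j, z; split=> //; right].
  by move=> [j [z [[[_ <- <-]|jz] zy]]]; [left|right; exists j, z].
have := IH; congr B; apply/seteqP; split=> y [j [z [jz zy]]]; exists j, z;
  split=> //; first by right.
by case: jz => // -[].
Qed.

Lemma atomic_completeness (F : frame) (B : set (set F)) (n : nat) (w0 : F)
    (v0 : nat -> set F) (Theta : set form) :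
  (forall v a, (forall p, B (v p)) -> B (gsem B v a)) ->
  (forall p, B (v0 p)) ->
  (forall x y, (forall X, B X -> X x -> X y) -> x = y) ->
  (forall X x, B X -> X x -> exists j y, [/\ j <= n, racc j w0 y & X y]) ->
  gsem B v0 (At n) w0 -> gsem B v0 (Rax n) w0 ->
  (forall v a x, (forall p, B (v p)) -> Theta a -> gsem B v a x) ->
  Theta `<=` quantifier_free -> Theta `<=` sahlqvist ->
  class_diversity (KFr Theta) n ->
  exists2 G : frame, KFr Theta G &
    exists (v : nat -> set G) (x : G), forall a, sem v a x <-> gsem B v0 a w0.
Proof.
move=> closed Bv0 sep reach w0_At w0_Rax BTheta Tqf Ts [div _].
pose G := atom_frame closed Bv0 sep reach w0_At.
pose BG : set (set G) := @atom_sets F B n w0 v0 closed Bv0 sep reach w0_At.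
have closedG v a : (forall p, BG (v p)) -> BG (gsem BG v a).
  exact: atom_closed.
have BG1 (x : G) : BG [set x] by apply: atom_singleton.
have BGimage X : BG X -> BG [set y | exists2 x, X x & acc x y].
  exact: atom_image.
have KG : KFr Theta G.
  move=> a Ta; apply: (@sahlqvist_persistent _ BG) => //.
  - have h := closedT closedG (BG1 (atom_root closed Bv0 sep reach w0_At)). exact: h.
  - exact: closedI closedG.
  - move=> l b x _ bx; exists (min_val l); split=> // p; last by [].
    exact: min_val_closed.
  - exact: Ts _ Ta.
  move=> U BU; have [u Bu ->] := atom_sets_val BU; rewrite -(gsem_qf BG) -?subTset;
    last exact: Tqf _ Ta.
  by move=> x _; apply/atom_gsem => //; apply: BTheta.
exists G => //; pose r : G := atom_root closed Bv0 sep reach w0_At.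
have reachG z : clos_refl_trans G (@acc G) r z.
  by have [k /racc_clos] := atom_reach w0_Rax z.
have [rs hrs] := diversity_reps (div _ r KG) reachG.
pose v p : set G := @atom_trace F B n w0 v0 closed Bv0 sep reach w0_At (v0 p).
have BGv p : BG (v p) by exists (v0 p).
exists v, r => a; rewrite (full_semantics closedG BGv BG1 BGimage hrs _ _ BGv).
exact: atom_gsem.
Qed.

Theorem theorem5p2 (Theta : set form) (n : nat)
    (Theta_qf : Theta `<=` quantifier_free)
    (Theta_sahlqvist : Theta `<=` sahlqvist)
    (KFr_diversity : class_diversity (KFr Theta) n) :
  let L := KPi (Theta `|` Bc `|` [set At n] `|` [set Rax n]) in
  sound L (KFr Theta) /\ strongly_complete L (KFr Theta).
Proof.
move=> L; split; first exact: soundness.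
have HL : npqml L := npqml_smallest _.
have axL : Theta `|` Bc `|` [set At n] `|` [set Rax n] `<=` L := @KPi_axiom _.
have ThL : Theta `<=` L by move=> a Ta; apply: axL; left; left; left.
have BcL : Bc `<=` L by move=> a Ta; apply: axL; left; left; right.
have AtL : L (At n) by apply: axL; left; right.
have RaxL : L (Rax n) by apply: axL; right.
have master a := L_master HL a ThL Theta_qf Theta_sahlqvist KFr_diversity.
move=> Gamma /(consistent_witnessed HL)[w [mw ww wG]].
pose F := sat_frame HL n mw ww.
pose B : set (set F) := @form_sets L HL n w mw ww.
pose v0 : nat -> set F := fun p => @form_set L HL n w mw ww (Var p).
have Bv0 p : B (v0 p) by exists (Var p).
pose w0 : F := sat_root HL n mw ww.
have [G KG [v [x vx]]] : exists2 G : frame, KFr Theta G &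
    exists (v : nat -> set G) (x : G), forall a, sem v a x <-> gsem B v0 a w0.
  apply: (@atomic_completeness F B n w0 v0) => //.
  - by move=> u a Bu; apply: sat_closed.
  - exact: sat_separated.
  - by move=> X y; apply: sat_reach.
  - exact: sat_valid_at.
  - exact: sat_valid_at.
  - by move=> u a y Bu Ta; apply: sat_valid_at => //; apply: ThL.
(* Reading the valuation at doubled indices undoes the renaming to even variables. *)
exists G; split=> //; exists (fun p => v p.*2), x => a /wG wa.
suff : sem v (subst (fun p => Var p.*2) a) x by rewrite -!gsemT gsem_subst.
by apply/vx/sat_truth_id.
Qed.
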